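(* Let $K$ be a field with $\mathbb{R}\subset K$, let $\mathcal{P}=\mathrm{conv}(v_1,\ldots,v_m)$ with $v_1,\ldots,v_m\in\mathbb{N}^s$, let $d=\dim\mathcal{P}$, and let $f$ be a non-zero polynomial of degree $p$ in $K[t_1,\ldots,t_s]$. The following hold. (a) $E_{\mathcal{P}}^{s,f}$ is a polynomial of $n$ of degree at most $d+p$ and $F_{\mathcal{P}}^{s,f}(x)$ is a rational function. (b) If $\mathcal{P}$ is non-degenerate and $f$ is a monomial, then $\deg(E_{\mathcal{P}}^{s,f})=d+p$. (c) $E_{\mathcal{P}}^{s,f}$ is a $K$-linear combination of Ehrhart polynomials. (d) If the interior of $\mathcal{P}$ is nonempty, $K=\mathbb{R}$, $f$ is homogeneous and $f\ge0$ on $\mathcal{P}$, then $E_{\mathcal{P}}^{s,f}$ is a polynomial of degree $s+p$.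
   Context: $\mathbb{N}=\{0,1,2,\ldots\}$. For a polynomial $f$, the $s$-weighted Ehrhart function is $E_{\mathcal{P}}^{s,f}(n)=\sum_{a\in n\mathcal{P}\cap\mathbb{Z}^s}f(a)$ and the $s$-weighted Ehrhart series is $F_{\mathcal{P}}^{s,f}(x)=\sum_{n\ge0}E_{\mathcal{P}}^{s,f}(n)x^n$ (the superscript $s$ names the weighting). A function $E:\mathbb{N}\to K$ is called a polynomial if there is $g\in K[x]$ with $E(n)=g(n)$ for all $n\in\mathbb{N}$; its degree is that of $g$. An Ehrhart polynomial is the polynomial $E_{\mathcal{Q}}(n)=|n\mathcal{Q}\cap\mathbb{Z}^N|$ of a lattice polytope $\mathcal{Q}\subset\mathbb{R}^N$ (any $N$). $\mathcal{P}=\mathrm{conv}(v_1,\ldots,v_m)$ is non-degenerate if for each $1\le i\le s$ there is some $v_j$ whose $i$-th entry is non-zero. *)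

(* Defs.v *)
From mathcomp Require Import all_boot all_order all_algebra finmap.
From mathcomp Require Import all_classical all_reals topology normedtype.
(* The notations of [mpoly] clash with those of MathComp-Analysis. *)
From mathcomp Require Import -(notations) mpoly.

Set Implicit Arguments.
Unset Strict Implicit.
Unset Printing Implicit Defensive.

Import Order.TTheory GRing.Theory Num.Theory.
Import numFieldNormedType.Exports.

Local Open Scope classical_set_scope.
Local Open Scope ring_scope.

Definition convex_hull (R : realType) (s m : nat) (v : 'I_m -> 'rV[R]_s)
    : set 'rV[R]_s :=
  [set x | exists w : 'I_m -> R,
    [/\ forall i, 0 <= w i, \sum_i w i = 1 & x = \sum_i w i *: v i]].

Definition affine_hull (R : realType) (s : nat) (A : set 'rV[R]_s) : set 'rV[R]_s :=
  [set x | exists (k : nat) (y : 'I_k -> 'rV[R]_s) (w : 'I_k -> R),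
    [/\ forall i, A (y i), \sum_i w i = 1 & x = \sum_i w i *: y i]].

(* The affine hull of [A] is a translate of a linear subspace of dimension [d],
   here the row space of [U].  No [d] qualifies when [A] is empty. *)
Definition has_dim (R : realType) (s : nat) (A : set 'rV[R]_s) (d : nat) : Prop :=
  exists (x0 : 'rV[R]_s) (U : 'M[R]_s),
    affine_hull A = [set x | (x - x0 <= U)%MS] /\ \rank U = d.

Definition nondegenerate_vertices (s m : nat) (v : 'I_m -> 'rV[nat]_s) : Prop :=
  forall i : 'I_s, exists j : 'I_m, v j 0 i != 0%N.

Definition dilate_lattice_points (R : realType) (s : nat) (A : set 'rV[R]_s) (n : nat)
    : set 'rV[int]_s :=
  [set a | exists2 x, A x & map_mx intr a = n%:R *: x].

Definition weighted_ehrhart (R : realType) (K : fieldType) (s : nat)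
    (A : set 'rV[R]_s) (f : mpoly s K) (n : nat) : K :=
  \sum_(a \in dilate_lattice_points A n) meval (fun i => (a 0 i)%:~R) f.

Definition ehrhart (R : realType) (N : nat) (Q : set 'rV[R]_N) (n : nat) : nat :=
  #|` fset_set (dilate_lattice_points Q n)|%fset.

Definition lattice_polytope (R : realType) (N : nat) (Q : set 'rV[R]_N) : Prop :=
  exists (k : nat) (u : 'I_k.+1 -> 'rV[int]_N),
    Q = convex_hull (fun j => map_mx intr (u j)).

Definition ehrhart_polynomial (R : realType) (e : nat -> nat) : Prop :=
  exists (N : nat) (Q : set 'rV[R]_N), lattice_polytope Q /\ e = ehrhart Q.

Definition represents (K : fieldType) (g : {poly K}) (E : nat -> K) : Prop :=
  forall n, E n = g.[n%:R].

(* A sequence [F] stands for the formal power series with coefficients [F n]. *)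
Definition power_series_mul (K : fieldType) (F G : nat -> K) (n : nat) : K :=
  \sum_(i < n.+1) F i * G (n - i)%N.

(* [F = P / Q] in [K[[x]]]; [Q] is invertible there iff [Q`_0 != 0]. *)
Definition rational_series (K : fieldType) (F : nat -> K) : Prop :=
  exists P Q : {poly K},
    Q`_0 != 0 /\ forall n, power_series_mul (fun i => Q`_i) F n = P`_n.

(* Main.v *)
Require Import Defs.
From mathcomp Require Import all_boot all_order all_algebra finmap ring lra zify.
From mathcomp Require polyrcf.
From mathcomp Require Import all_classical all_reals topology normedtype derive.
From mathcomp Require Import -(notations) mpoly.

Set Implicit Arguments.
Unset Strict Implicit.
Unset Printing Implicit Defensive.

Import Order.TTheory GRing.Theory Num.Theory.
Import numFieldNormedType.Exports.

Local Open Scope classical_set_scope.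
Local Open Scope ring_scope.

(** Everything reduces to Ehrhart's theorem on lattice polytopes without weights,
    plus counting estimates.

    Part (c).  For a lattice point [a] with natural coordinates, [a_i + 1] counts
    the integers [b] with [0 <= b <= a_i].  Hence summing [F a * (a_i + 1)] over
    the lattice points of [n P] is the same as summing [F] over the lattice points
    [(a, b)] of [n P'], where [P'] is the prism
    [{(x, y) | x in P, 0 <= y <= x_i}], again a lattice polytope with natural
    vertices ([prismP], [sum_dilate_prism]).  Iterating, the sum of a product of
    factors [a_i + 1] is an Ehrhart polynomial ([sum_succ_prod_ehrhart]); since
    [a_i = (a_i + 1) - 1], every monomial, hence every [f], gives a linear
    combination of Ehrhart polynomials ([ehrhart_span_weighted]).

    Ehrhart's theorem ([lattice_polytope_ehrhart_poly]).  Pass to the cone over the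
    polytope.  The indicator function of the cone is a linear combination of
    indicators of cones on nonempty linearly independent subsets of the generators
    ([cone_simplicial_combination]).  This is proved by adding generators one at a
    time: adjoining [w] to a cone [C] replaces the indicator of [C] at [x] by the
    Euler characteristic of the interval of those [t >= 0] with [x - t w] in [C],
    and the Euler characteristic is linear in indicator functions
    ([interval_euler_char], [cone_ind_adjoin]); the generators then satisfy at most
    one linear relation, and inclusion-exclusion over the positive coefficients of
    that relation restores independence ([cone_circuit]).  For independent
    generators, shifting by a generator gives a recursion on lattice points with
    some barycentric coordinates restricted to [[0, 1)] ([card_lattice_sliceS]), and
    with all [k] coordinates restricted nothing is left in degree [k] and above;
    summing [k] times gives a polynomial valid for every [n >= 0].  Open
    cones, or the cone on no generators, would spoil the value at [n = 0].

    Degrees.  They are read off from growth.  Lattice points of [n P] inject into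
    [d] of their coordinates, each in [[0, n M]], so monomial sums are
    [O(n^(d + |e|))] ([monomial_sum_le]).  For (b), a lattice parallelepiped of
    dimension [d] inside a fixed multiple of [P], translated by a sum of all
    vertices, provides [t^d] points with all coordinates at least [t]
    ([monomial_sum_ge]).  For (d), [f] is bounded below by a positive constant on
    some ball in [P], because a nonzero polynomial does not vanish on a box, and
    homogeneity scales this to [n P] ([weighted_ehrhart_ge]). *)

(** * Polynomials: antiderivatives, growth and power series *)

(** The difference of [X^(k+1)] telescopes into [k+1] monic terms of degree [k], so
    in characteristic zero it has the leading term [(k+1) X^k], and the top coefficient
    of [g] can be cancelled by induction. *)
Lemma discrete_antiderivative (R : numFieldType) (g : {poly R}) :
  exists G : {poly R}, forall x, G.[x] - G.[x - 1] = g.[x].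
Proof.
move: {2}(size g) (leqnn (size g)) => k.
elim: k g => [|k IH] g.
  by rewrite leqn0 size_poly_eq0 => /eqP->; exists 0 => x; rewrite !horner0 subrr.
(* [h] is the telescoped difference [X^(k+1) - (X - 1)^(k+1)]. *)
move=> sg; pose h : {poly R} := \sum_(i < k.+1) 'X^(k - i) * ('X - 1%:P) ^+ i.
have hmon (i : 'I_k.+1) :
    ('X^(k - i) * ('X - 1%:P) ^+ i : {poly R}) \is monic /\
    size ('X^(k - i) * ('X - 1%:P) ^+ i : {poly R}) = k.+1.
  have mX : ('X - 1%:P : {poly R}) ^+ i \is monic by apply/monic_exp/monicXsubC.
  split; first by rewrite monicMl ?monicXn.
  rewrite size_Mmonic ?monic_neq0 ?monicXn// size_polyXn size_exp_XsubC.
  by have := ltn_ord i; lia.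
have sh : (size h <= k.+1)%N.
  apply: (leq_trans (size_sum _ _ _)); apply/bigmax_leqP => i _.
  by rewrite (hmon i).2.
have hk : h`_k = k.+1%:R.
  rewrite /h coef_sum (eq_bigr (fun _ => 1)).
    by rewrite sumr_const card_ord.
  move=> i _; have [/monicP + si] := hmon i.
  by rewrite lead_coefE si.
have hE x : h.[x] = x ^+ k.+1 - (x - 1) ^+ k.+1.
  rewrite subrXX opprB addrCA subrr addr0 mul1r /h horner_sum.
  by apply: eq_bigr => i _; rewrite !hornerE.
pose c := g`_k / k.+1%:R.
have [|G HG] := IH (g - c *: h).
  apply/leq_sizeP => j; rewrite leq_eqVlt coefB coefZ => /orP[/eqP<-|kj].
    by rewrite hk /c divfK ?pnatr_eq0// subrr.
  by rewrite (leq_sizeP _ _ sg)// (leq_sizeP _ _ sh)// mulr0 subrr.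
exists (G + c *: 'X^(k.+1)) => x; have := HG x.
by rewrite !hornerE hE => {}HG; rewrite opprD addrACA HG -mulrBr subrK.
Qed.

Lemma poly_eventually_pos (R : realType) (g : {poly R}) :
  0 < lead_coef g -> exists N : nat, forall n, (N <= n)%N -> 0 < g.[n%:R].
Proof.
move=> lg; have [x0 Hx0] := polyrcf.poly_pinfty_gt_lc lg.
exists (Num.bound x0) => n Nn; apply: lt_le_trans lg _; apply: Hx0.
apply: (le_trans (ler_norm _)); apply: (le_trans (ltW (archi_boundP (normr_ge0 _)))).
by rewrite ler_nat; move: Nn; rewrite /Num.bound normr_id.
Qed.

(** If the degree exceeded [k], then [g - C (X + 1)^k] would keep the leading
    coefficient of [g] and be eventually positive. *)
Lemma size_poly_of_le_growth (R : realType) (g : {poly R}) (C : R) (k : nat) :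
  (forall n, `|g.[n%:R]| <= C * n.+1%:R ^+ k) -> (size g <= k.+1)%N.
Proof.
move=> Hg; rewrite leqNgt; apply/negP => sg.
wlog lg : g Hg sg / 0 < lead_coef g.
  move=> W; have [lg|] := ltP 0 (lead_coef g); first exact: (W g).
  rewrite le_eqVlt lead_coef_eq0 => /orP[/eqP g0|lg].
    by move: sg; rewrite g0 size_poly0.
  apply: (W (- g)); rewrite ?size_polyN// ?lead_coefN ?oppr_gt0//.
  by move=> n; rewrite hornerN normrN.
have sX : (size (C *: ('X + 1%:P) ^+ k) <= k.+1)%N.
  by rewrite (leq_trans (size_scale_leq _ _))// -[1]opprK polyCN size_exp_XsubC.
have [|N /(_ N (leqnn _))] :=
    @poly_eventually_pos R (g - C *: ('X + 1%:P) ^+ k).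
  by rewrite lead_coefDl ?size_polyN// (leq_ltn_trans sX).
rewrite !hornerE natr1 subr_gt0 ltNge => /negP; apply.
exact: le_trans (ler_norm _) (Hg N).
Qed.

Lemma size_poly_of_ge_growth (R : realType) (g : {poly R}) (c : R) (k : nat) :
  0 < c -> (forall N : nat, exists2 n, (N <= n)%N & c * n%:R ^+ k <= g.[n%:R]) ->
  (k < size g)%N.
Proof.
move=> c0 Hg; rewrite ltnNge; apply/negP => sg.
have sX : size (c *: 'X^k : {poly R}) = k.+1.
  by rewrite size_scale ?gt_eqF// size_polyXn.
have [|N HN] := @poly_eventually_pos R (c *: 'X^k - g).
  by rewrite lead_coefDl ?size_polyN ?sX ?ltnS// lead_coefZ lead_coefXn mulr1.
have [n Nn] := Hg N; apply/negP; rewrite -ltNge.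
by have := HN n Nn; rewrite !hornerE subr_gt0.
Qed.

Lemma size_backward_difference (K : fieldType) (g : {poly K}) (D : nat) :
  (size g <= D.+1)%N -> (size (g - (g \Po ('X - 1%:P)))%R <= D)%N.
Proof.
have sX : size ('X - 1%:P : {poly K}) = 2%N by rewrite size_XsubC.
have lX : lead_coef ('X - 1%:P : {poly K}) = 1 by rewrite lead_coefXsubC.
have sgc : size (g \Po ('X - 1%:P)) = size g by rewrite size_comp_poly2.
have lgc : lead_coef (g \Po ('X - 1%:P)) = lead_coef g.
  by rewrite lead_coef_comp ?sX// lX expr1n mulr1.
rewrite leq_eqVlt => /orP[/eqP sg|sg]; last first.
  by rewrite (leq_trans (size_polyD _ _))// geq_max size_polyN sgc -ltnS sg.
apply/leq_sizeP => j; rewrite leq_eqVlt coefB => /orP[/eqP<-|Dj].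
  by move: lgc; rewrite !lead_coefE sgc sg /= => ->; rewrite subrr.
by rewrite !nth_default ?sgc ?sg// subrr.
Qed.

(** Multiplying a power series by [1 - X] takes backward differences of its
    coefficients; each difference lowers the degree of [g] and shortens by one index
    the range where the coefficients are polynomial. *)
Lemma power_series_mul_eq0 (K : fieldType) (D N : nat) (F : nat -> K)
    (g : {poly K}) : (size g <= D)%N ->
  (forall n, (N <= n)%N -> F n = g.[n%:R]) ->
  forall n, (N + D <= n)%N ->
    power_series_mul (fun i => ((1 - 'X) ^+ D)`_i) F n = 0.
Proof.
rewrite /power_series_mul; elim: D N F g => [|D IH] N F g.
  rewrite leqn0 size_poly_eq0 => /eqP-> HF n.
  rewrite addn0 => Nn; rewrite big_ord_recl expr0 coefC subn0 HF// horner0 mulr0.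
  by rewrite add0r big1// => i _; rewrite coefC mul0r.
move=> sg HF n Nn.
pose dF i := F i - (if i == 0%N then 0 else F i.-1).
transitivity (\sum_(i < n.+1) ((1 - 'X) ^+ D)`_i * dF (n - i)%N); last first.
  apply: (IH N.+1 dF (g - (g \Po ('X - 1%:P)))); last by rewrite addSn -addnS.
    exact: size_backward_difference.
  case=> // j Nj; rewrite /dF /= !HF//; last exact: leqW.
  by rewrite !hornerE horner_comp !hornerE -natr1 addrK.
(* Truncating [F] at degree [n] turns the convolutions into polynomial products. *)
pose T := \poly_(i < n.+1) F i.
have TE j : (j <= n)%N -> T`_j = F j by rewrite coef_poly ltnS => ->.
transitivity (((1 - 'X) ^+ D * ((1 - 'X) * T))`_n); last first.
  rewrite coefM; apply: eq_bigr => i _; congr (_ * _).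
  rewrite mulrBl mul1r coefB coefXM /dF.
  by case: eqVneq => [->|_]; rewrite !TE ?leq_subr// (leq_trans (leq_pred _))// leq_subr.
rewrite mulrA -exprSr coefM; apply: eq_bigr => i _.
by rewrite TE ?leq_subr.
Qed.

(** The denominator is [(1 - X)^D], with [D] greater than the degree. *)
Lemma rational_series_of_poly (K : fieldType) (F : nat -> K) (g : {poly K}) :
  represents g F -> rational_series F.
Proof.
move=> HF; pose D := size g; pose Q : {poly K} := (1 - 'X) ^+ D.
exists (\poly_(n < D) power_series_mul (fun i => Q`_i) F n), Q; split.
  rewrite -horner_coef0 /Q horner_exp !hornerE subr0 expr1n; exact: oner_neq0.
move=> n; rewrite coef_poly; case: ltnP => // Dn.
exact: (@power_series_mul_eq0 K D 0 F g).
Qed.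

(** * Indicator functions of cones are combinations of simplicial ones *)

(** The Euler characteristic of a closed interval is a linear functional of its
    indicator function: an interval contains exactly one point [t] such that [t + e] is
    outside it for all small [e > 0], namely its right end.  A single [e] and a single
    list [B] of right ends serve a finite family, so a linear relation between the
    indicators of its members passes to their Euler characteristics. *)
Lemma interval_euler_char (R : realType) (J : finType) (a b : J -> R) :
  exists (B : seq R) (e : R), forall j,
    (a j <= b j)%R%:R =
    \sum_(t <- B) ((a j <= t <= b j)%R%:R - (a j <= t + e <= b j)%R%:R) :> R.
Proof.
pose B := undup [seq b j | j <- enum J & a j <= b j].
(* [e] is smaller than every positive gap from a right end to another end. *)
have [e e0 He] : exists2 e : R, 0 < e & forall x y, x \in codom b ->
    y \in codom a ++ codom b -> x < y -> x + e < y.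
  have [e e0 He] : exists2 e : R, 0 < e & forall x, x \in
      [seq y - x | x <- codom b, y <- codom a ++ codom b] -> 0 < x -> e < x.
    elim: [seq _ | _ <- _, _ <- _] => [|z l [e e0 IH]]; first by exists 1.
    exists (Num.min e (if 0 < z then z / 2 else 1)).
      by rewrite lt_min e0 /=; case: ifP => z0; rewrite ?ltr01// divr_gt0.
    move=> x; rewrite inE => /predU1P[->|xl] x0; rewrite gt_min; last by rewrite IH.
    by rewrite x0 ltr_pdivrMr// mulr_natr mulr2n ltrDl x0 orbT.
  exists e => // x y xb yab xy; rewrite addrC -ltrBrDr He ?subr_gt0//.
  by apply/allpairsP; exists (x, y).
exists B, e => j.
have inb k : b k \in codom b by exact: codom_f.
have HB t : t \in B -> t \in codom b.
  by rewrite mem_undup => /mapP[k _ ->].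
have ina : a j \in codom a ++ codom b by rewrite mem_cat codom_f.
have inb' : b j \in codom a ++ codom b by rewrite mem_cat codom_f orbT.
transitivity (\sum_(t <- B) ((a j <= b j) && (t == b j))%:R : R).
  case: leP => ab /=; last by rewrite big1.
  have bB : b j \in B.
    by rewrite mem_undup; apply/mapP; exists j; rewrite // mem_filter ab mem_enum.
  rewrite (bigD1_seq (b j)) ?undup_uniq//= eqxx big1 ?addr0// => t /negPf->//.
rewrite big_seq [RHS]big_seq; apply: eq_bigr => t /HB tb.
have [ab|ba] /= := leP (a j) (b j); last first.
  have F s : (a j <= s <= b j) = false.
    by apply/negP => /andP[/le_trans h /h]; rewrite leNgt ba.
  by rewrite !F subrr.
have [->|tbj] := eqVneq t (b j).
  by rewrite lexx ab gerDl [e <= 0]leNgt e0 andbF subr0.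
have [tb'|tb'] := ltP t (b j); last first.
  have {tbj} tb' : b j < t by rewrite lt_neqAle eq_sym tbj.
  rewrite ![_ <= b j]leNgt tb' (lt_trans tb') ?ltrDl//=.
  by rewrite !andbF subrr.
rewrite (ltW tb') (ltW (He _ _ tb inb' tb')) !andbT.
have [ta|ta] := ltP t (a j).
  by rewrite leNgt (He _ _ tb ina ta) subrr.
by rewrite (le_trans ta) ?lerDl ?ltW// subrr.
Qed.

Section Cones.
Variables (R : realType) (N m : nat) (U : 'M[R]_(m, N)).

(** The weights live in the full space ['rV_m], zero off [S], so that weight
    vectors for different [S] can be compared. *)
Definition cone_weights (S : {set 'I_m}) (x : 'rV[R]_N) : set 'rV[R]_m :=
  [set y : 'rV[R]_m | [/\ forall i, 0 <= y 0 i, forall i, i \notin S -> y 0 i = 0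
             & y *m U = x]].

Definition cone (S : {set 'I_m}) : set 'rV[R]_N :=
  [set x | cone_weights S x !=set0].

Definition independent (T : {set 'I_m}) : Prop :=
  forall y : 'rV[R]_m, (forall i, i \notin T -> y 0 i = 0) -> y *m U = 0 -> y = 0.

Definition cone_ind (S : {set 'I_m}) (x : 'rV[R]_N) : R := `[< cone S x >]%:R.

(** The empty set of generators is excluded: its cone is the origin, whose lattice
    points are not counted by a polynomial in the degree. *)
Definition simplicial_combination (S : {set 'I_m}) (f : 'rV[R]_N -> R) : Prop :=
  exists c : {set 'I_m} -> R,
    (forall T, c T != 0 -> [/\ T \subset S, T != finset.set0 & independent T]) /\
    forall x, f x = \sum_T c T * cone_ind T x.

Lemma simplicial_combination_ext S f g :
  f =1 g -> simplicial_combination S f -> simplicial_combination S g.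
Proof. by move=> fg [c [Hc Hf]]; exists c; split=> // x; rewrite -fg. Qed.

Lemma simplicial_combination0 S : simplicial_combination S (fun=> 0).
Proof.
exists (fun=> 0); split=> [T|x]; first by rewrite eqxx.
by rewrite big1// => T _; rewrite mul0r.
Qed.

Lemma simplicial_combinationD S a f g :
  simplicial_combination S f -> simplicial_combination S g ->
  simplicial_combination S (fun x => f x + a * g x).
Proof.
move=> [c [Hc Hf]] [c' [Hc' Hg]]; exists (fun T => c T + a * c' T); split=> [T|x].
  have [c0|/Hc//] := eqVneq (c T) 0; have [c0'|/Hc'//] := eqVneq (c' T) 0.
  by rewrite c0 c0' mulr0 addr0 eqxx.
rewrite Hf Hg mulr_sumr -big_split; apply: eq_bigr => T _ /=.
by rewrite mulrDl mulrA.
Qed.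

Lemma simplicial_combination_sum S (J : finType) (c : J -> R)
    (f : J -> 'rV[R]_N -> R) :
  (forall j, c j != 0 -> simplicial_combination S (f j)) ->
  simplicial_combination S (fun x => \sum_j c j * f j x).
Proof.
move=> Hf; elim: (index_enum J) => [|j l IH].
  apply: simplicial_combination_ext (simplicial_combination0 S) => x.
  by rewrite big_nil.
have [cj|/Hf Hj] := eqVneq (c j) 0.
  by apply: simplicial_combination_ext IH => x; rewrite big_cons cj mul0r add0r.
apply: simplicial_combination_ext (simplicial_combinationD (c j) IH Hj) => x.
by rewrite big_cons addrC.
Qed.

Lemma simplicial_combination_cone (S T : {set 'I_m}) :
  T \subset S -> T != finset.set0 -> independent T ->
  simplicial_combination S (cone_ind T).
Proof.
move=> TS T0 Ti; exists (fun T' => (T' == T)%:R); split=> [T'|x].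
  by have [->|] := eqVneq T' T; rewrite ?eqxx.
rewrite (bigD1 T)//= eqxx mul1r big1 ?addr0// => T' /negPf->.
by rewrite mul0r.
Qed.

Variable delta : 'cV[R]_N.
Hypothesis degU : U *m delta = const_mx 1.

Lemma sum_cone_weights S x y :
  cone_weights S x y -> \sum_i y 0 i = (x *m delta) 0 0.
Proof.
move=> [_ _ <-]; rewrite -mulmxA degU mxE.
by apply: eq_bigr => i _; rewrite mxE mulr1.
Qed.

(** The weights sum to the degree of [x], so they are bounded. *)
Lemma cone_weights_compact S x : compact (cone_weights S x).
Proof.
have coordC i : continuous (fun y : 'rV[R]_m => y 0 i) by exact: coord_continuous.
apply: bounded_closed_compact.
  exists ((x *m delta) 0 0); split; first exact: num_real.
  move=> M HM y Hy /=; have sy := sum_cone_weights Hy; case: Hy => y0 _ _.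
  rewrite /Num.norm/= mx_normrE; apply/bigmax_leP; split.
    apply: le_trans (ltW HM); rewrite -sy; exact: sumr_ge0.
  move=> [i j] _ /=; rewrite ord1 ger0_norm//; apply: le_trans (ltW HM).
  by rewrite -sy (bigD1 j)//= lerDl sumr_ge0.
have -> : cone_weights S x =
    \bigcap_(i in [set: 'I_m]) [set y : 'rV[R]_m | 0 <= y 0 i] `&`
    (\bigcap_(i in [set i | i \notin S]) [set y : 'rV[R]_m | y 0 i = 0] `&`
     \bigcap_(j in [set: 'I_N]) [set y : 'rV[R]_m | \sum_i y 0 i * U i j = x 0 j]).
  apply/seteqP; split=> y.
    move=> [y0 yS yx]; split; first by move=> i _; exact: y0.
    split; first by move=> i; exact: yS.
    by move=> j _ /=; rewrite -yx mxE.
  move=> [y0 [yS yx]]; split; first by move=> i; exact: y0.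
    by move=> i; exact: yS.
  by apply/rowP => j; rewrite mxE; exact: yx.
apply: closedI; first apply: closed_bigI => i _.
  exact: (proj1 (continuous_closedP _) (coordC i) _ (@closed_ge R 0)).
apply: closedI; apply: closed_bigI => i _.
  exact: (proj1 (continuous_closedP _) (coordC i) _ (@closed_eq R 0)).
have linC : continuous (fun y : 'rV[R]_m => \sum_k y 0 k * U k i).
  apply: continuous_big => [|k _ y]; first exact: add_continuous.
  by apply: continuousM; [exact: coordC | exact: cst_continuous].
exact: (proj1 (continuous_closedP _) linC _ (@closed_eq R (x 0 i))).
Qed.

(** A coordinate of a compact convex set ranges over a closed interval, possibly
    empty. *)
Lemma cone_weights_coord S w x : exists a b, forall t,
  (exists2 y, cone_weights S x y & y 0 w = t) <-> a <= t <= b.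
Proof.
have [NE|E] := pselect (cone_weights S x !=set0); last first.
  exists 1, 0 => t; split=> [[y Hy _]|/andP[/le_trans h /h]]; last by rewrite ler10.
  by case: E; exists y.
have cont : {within cone_weights S x, continuous (fun y : 'rV[R]_m => y 0 w)}.
  by apply: continuous_subspaceT; exact: coord_continuous.
have [y Hy ymax] := EVT_max_rV NE (@cone_weights_compact S x) cont.
have [z Hz zmin] := EVT_min_rV NE (@cone_weights_compact S x) cont.
exists (z 0 w), (y 0 w) => t; split.
  by move=> [u Hu <-]; rewrite ymax ?inE// zmin ?inE.
move: Hy Hz; rewrite !inE => -[y0 yS yx] [z0 zS zx] /andP[zt ty].
have [yz|yz] := eqVneq (y 0 w) (z 0 w).
  by exists y => //; apply/le_anti; rewrite ty yz zt.
have {yz} yz : 0 < y 0 w - z 0 w.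
  by rewrite subr_gt0 lt_neqAle eq_sym yz (le_trans zt).
pose k := (t - z 0 w) / (y 0 w - z 0 w).
have k0 : 0 <= k by rewrite divr_ge0 ?subr_ge0// -subr_ge0 ltW.
have k1 : k <= 1 by rewrite ler_pdivrMr// mul1r lerB.
exists (k *: y + (1 - k) *: z); last first.
  by rewrite !mxE /k; field; rewrite gt_eqF.
split=> [i|i iS|]; rewrite ?mxE.
- by rewrite addr_ge0// mulr_ge0// subr_ge0.
- by rewrite yS// zS// !mulr0 addr0.
- by rewrite mulmxDl -!scalemxAl yx zx -scalerDl addrC subrK scale1r.
Qed.

(** The set [{t >= 0 | x - t w in cone T}] is a closed interval, nonempty exactly
    when [x] is in the cone on [w |: T].  The assumed relation, read along the line
    [x - t w], relates the indicators of these intervals, hence their Euler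
    characteristics. *)
Lemma cone_ind_adjoin (S : {set 'I_m}) w (c : {set 'I_m} -> R) :
  (forall T, c T != 0 -> T \subset S) -> w \notin S ->
  (forall x, cone_ind S x = \sum_T c T * cone_ind T x) ->
  forall x, cone_ind (w |: S) x = \sum_T c T * cone_ind (w |: T) x.
Proof.
move=> cS wS HS x.
have /choice[ab Hab] : forall T, exists ab : R * R, forall t,
    (exists2 y, cone_weights (w |: T) x y & y 0 w = t) <-> ab.1 <= t <= ab.2.
  by move=> T; have [a [b ?]] := cone_weights_coord (w |: T) w x; exists (a, b).
have indE T : cone_ind (w |: T) x = ((ab T).1 <= (ab T).2)%R%:R.
  congr (_%:R); congr nat_of_bool; apply/asboolP/idP => [[y Hy]|le12].
    have /andP[] : (ab T).1 <= y 0 w <= (ab T).2 by apply/Hab; exists y.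
    exact: le_trans.
  have [|y Hy _] := (Hab T (ab T).1).2; first by rewrite lexx.
  by exists y.
(* The intervals are the ranges of the weight of [w]. *)
have itvE (T : {set 'I_m}) t : w \notin T ->
    ((ab T).1 <= t <= (ab T).2)%R%:R = (0 <= t)%R%:R * cone_ind T (x - t *: row w U).
  move=> wT; rewrite -natrM mulnb; congr (_%:R); congr nat_of_bool.
  apply/idP/idP.
    move=> /Hab[y [y0 yS yx] ywt]; rewrite -ywt y0 /=; apply/asboolP.
    exists (y - y 0 w *: delta_mx 0 w); split=> [i|i iT|].
    - rewrite !mxE eqxx /=; have [->|iw] := eqVneq; first by rewrite mulr1 subrr.
      by rewrite mulr0 subr0.
    - rewrite !mxE eqxx /=; have [->|iw] := eqVneq; first by rewrite mulr1 subrr.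
      by rewrite mulr0 subr0 yS// !inE negb_or iw.
    - by rewrite mulmxBl yx -scalemxAl rowE.
  move=> /andP[t0 /asboolP[y [y0 yS yx]]]; apply/Hab.
  exists (y + t *: delta_mx 0 w); last by rewrite !mxE !eqxx mulr1 yS// add0r.
  split=> [i|i|].
  - by rewrite !mxE addr_ge0// mulr_ge0// ler0n.
  - rewrite !inE negb_or => /andP[iw iT].
    by rewrite !mxE yS// (negPf iw) andbF mulr0 addr0.
  - by rewrite mulmxDl yx -scalemxAl -rowE subrK.
have itvS t : ((ab S).1 <= t <= (ab S).2)%R%:R =
    \sum_T c T * ((ab T).1 <= t <= (ab T).2)%R%:R.
  rewrite itvE// HS mulr_sumr; apply: eq_bigr => T _.
  have [->|/cS TS] := eqVneq (c T) 0; first by rewrite !mul0r mulr0.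
  by rewrite itvE ?(contra (fintype.subsetP TS w))// mulrCA.
have [B [e HB]] := interval_euler_char (fun T => (ab T).1) (fun T => (ab T).2).
rewrite indE HB; under eq_bigr do rewrite !itvS.
transitivity (\sum_T c T * \sum_(t <- B)
    (((ab T).1 <= t <= (ab T).2)%R%:R - ((ab T).1 <= t + e <= (ab T).2)%R%:R)).
  under [RHS]eq_bigr do rewrite mulr_sumr.
  rewrite exchange_big; apply: eq_bigr => t _ /=.
  by rewrite -sumrB; apply: eq_bigr => T _; rewrite mulrBr.
by apply: eq_bigr => T _; rewrite indE HB.
Qed.

(** If [w |: T] is dependent, its relations are the multiples of a single [l] with
    [l_w = -1], and some coefficient of [l] is positive because degrees sum to zero.
    Let [Vp] be the set of positive coefficients.  Subtracting the largest possible
    multiple of [l] shows that the cone is the union of the cones without [i], for [i]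
    in [Vp]; two weight vectors of the same point differ by a multiple of [l], so these
    cones intersect in the expected way, and inclusion-exclusion applies. *)
Lemma cone_circuit (T : {set 'I_m}) w : w \notin T -> independent T ->
  simplicial_combination (w |: T) (cone_ind (w |: T)).
Proof.
move=> wT Ti; set V := w |: T.
have wV : w \in V by rewrite finset.setU11.
have V0 (S : {set 'I_m}) : w \notin S -> V :\: S != finset.set0.
  by move=> wS; apply/finset.set0Pn; exists w; rewrite inE wV andbT.
have [Vi|/existsNP[l0 /not_implyP[l0V /not_implyP[l0U l0n]]]] := pselect (independent V).
  apply: simplicial_combination_cone => //.
  by apply/finset.set0Pn; exists w.
have offT (y : 'rV[R]_m) : (forall i, i \notin V -> y 0 i = 0) -> y *m U = 0 ->
    y 0 w = 0 -> y = 0.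
  move=> yV yU yw; apply: Ti yU => i iT.
  by have [->//|iw] := eqVneq i w; rewrite yV// !inE negb_or iw.
have l0w : l0 0 w != 0 by apply/eqP => /(offT _ l0V l0U).
pose l : 'rV[R]_m := - (l0 0 w)^-1 *: l0.
have lV i : i \notin V -> l 0 i = 0 by move=> iV; rewrite /l mxE (l0V i iV) mulr0.
have lU : l *m U = 0 by rewrite -scalemxAl l0U scaler0.
have lw : l 0 w = -1 by rewrite /l mxE mulNr mulVf.
clearbody l.
have kernel (y : 'rV[R]_m) : (forall i, i \notin V -> y 0 i = 0) -> y *m U = 0 ->
    y = - y 0 w *: l.
  move=> yV yU; apply/eqP; rewrite -subr_eq0 scaleNr opprK; apply/eqP; apply: offT.
  - by move=> i iV; rewrite !mxE (yV i iV) (lV i iV) mulr0 addr0.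
  - by rewrite mulmxDl yU -scalemxAl lU scaler0 addr0.
  - by rewrite !mxE lw mulrN1 subrr.
have suml : \sum_i l 0 i = 0.
  have := congr1 (fun M : 'rV_N => (M *m delta) 0 0) lU.
  rewrite -mulmxA degU mul0mx !mxE => {2}<-; apply: eq_bigr => i _.
  by rewrite [const_mx _ _ _]mxE mulr1.
pose Vp : {set 'I_m} := [set i | 0 < l 0 i]%SET.
have wVp : w \notin Vp by rewrite inE lw oppr_gt0 ltr10.
have cone_sub (A B : {set 'I_m}) x : A \subset B -> cone A x -> cone B x.
  move=> AB [y [y0 yA yx]]; exists y; split=> // i iB.
  by rewrite yA// (contra (fintype.subsetP AB i)).
have cover x : cone V x -> exists2 i, i \in Vp & cone (V :\ i) x.
  move=> [y [y0 yV yx]].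
  have [i0 Hi0] : exists i, i \in Vp.
    have /existsP[i] : [exists i, i \in Vp]; last by exists i.
    apply: contraT => /existsPn Hn; have : \sum_i l 0 i < 0.
      rewrite (bigD1 w)//= lw; apply: ltr_wnDr; last by rewrite oppr_lt0.
      by apply: sumr_le0 => i _; move: (Hn i); rewrite inE -leNgt.
    by rewrite suml ltxx.
  have [i iVp imin] : exists2 i, i \in Vp &
      forall j, j \in Vp -> y 0 i / l 0 i <= y 0 j / l 0 j.
    by case: (arg_minP (fun i => y 0 i / l 0 i) Hi0) => i iVp imin; exists i.
  have li : 0 < l 0 i by move: iVp; rewrite inE.
  exists i => //; exists (y - (y 0 i / l 0 i) *: l); split=> [j|j|].
  - rewrite !mxE subr_ge0.
    have [lj|lj] := ltP 0 (l 0 j).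
      by rewrite -ler_pdivlMr// imin// inE.
    by apply: le_trans (y0 j); rewrite mulr_ge0_le0// divr_ge0// ltW.
  - rewrite !mxE in_setD1 negb_and negbK => /orP[/eqP->|jV].
      by rewrite divfK ?subrr// gt_eqF.
    by rewrite (yV j jV) (lV j jV) mulr0 subr0.
  - by rewrite mulmxBl yx -scalemxAl lU scaler0 subr0.
have indM (S0 : {set 'I_m}) i x : S0 \subset Vp -> i \in Vp ->
    cone_ind (V :\: S0) x * cone_ind (V :\ i) x = cone_ind (V :\: (i |: S0)) x.
  move=> S0Vp iVp; rewrite -natrM mulnb; congr (_%:R); congr nat_of_bool.
  apply/idP/idP; last first.
    move=> /asboolP H; apply/andP; split; apply/asboolP; apply: cone_sub H;
      by rewrite finset.setDS// ?finset.subsetUr ?finset.subsetUl.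
  move=> /andP[/asboolP[y [y0 yS yx]] /asboolP[z [z0 zi zx]]]; apply/asboolP.
  have [->|[j jS]] := finset.set_0Vmem S0.
    by exists z; split=> // k kS; rewrite zi//; move: kS; rewrite finset.setU0.
  have yzV k : k \notin V -> (y - z) 0 k = 0.
    by move=> kV; rewrite !mxE yS ?zi ?subr0// inE negb_and kV orbT.
  have yzU : (y - z) *m U = 0 by rewrite mulmxBl yx zx subrr.
  have yzE := kernel _ yzV yzU; set k := - (y - z) 0 w in yzE.
  have yzk t : y 0 t - z 0 t = k * l 0 t.
    by have := congr1 (fun M : 'rV_m => M 0 t) yzE; rewrite !mxE.
  have li : 0 < l 0 i by move: iVp; rewrite inE.
  have lj : 0 < l 0 j by move: (fintype.subsetP S0Vp _ jS); rewrite inE.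
  have k0 : k = 0.
    apply/le_anti/andP; split.
      rewrite -(pmulr_lle0 _ lj) -yzk yS ?inE ?jS// sub0r oppr_le0; exact: z0.
    by rewrite -(pmulr_lge0 _ li) -yzk zi ?inE ?eqxx// subr0; exact: y0.
  have yz : y = z by apply/eqP; rewrite -subr_eq0 yzE k0 scale0r.
  exists y; split=> // t; rewrite finset.in_setD in_setU1 negb_and negbK -orbA.
  move=> /or3P[/eqP->|tS|tV].
  - by rewrite yz zi// in_setD1 eqxx.
  - by rewrite yS// finset.in_setD tS.
  - by rewrite yS// finset.in_setD (negPf tV) andbF.
(* Multiplying by [1 - cone_ind (V :\ i)] splits a partial product into a
   difference of two shorter ones, all of whose cones omit some element of [Vp]. *)
have simpl_part (L : seq 'I_m) (S0 : {set 'I_m}) : {subset L <= Vp} -> S0 \subset Vp ->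
    S0 != finset.set0 -> simplicial_combination V
      (fun x => cone_ind (V :\: S0) x * \prod_(i <- L) (1 - cone_ind (V :\ i) x)).
  elim: L S0 => [|i L IH] S0 LV S0V S00.
    apply: simplicial_combination_ext (_ : simplicial_combination V (cone_ind (V :\: S0))).
      by move=> x; rewrite big_nil mulr1.
    apply: simplicial_combination_cone; first exact: finset.subsetDl.
      by apply: V0; apply: contra wVp; exact: (fintype.subsetP S0V).
    have [j jS] := finset.set0Pn _ S00.
    have lj : 0 < l 0 j by move: (fintype.subsetP S0V _ jS); rewrite inE.
    move=> y yS yU.
    have yE : y = - y 0 w *: l.
      by apply: kernel => // k kV; rewrite yS// inE negb_and kV orbT.
    have : y 0 j = 0 by rewrite yS// inE jS.
    rewrite {1}yE mxE => /eqP; rewrite mulf_eq0 (gt_eqF lj) orbF => /eqP k0.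
    by rewrite yE k0 scale0r.
  have iV : i \in Vp by apply: LV; rewrite mem_head.
  have LV' : {subset L <= Vp} by move=> j jL; apply: LV; rewrite inE jL orbT.
  apply: simplicial_combination_ext (simplicial_combinationD (-1) (IH S0 LV' S0V S00)
    (IH (i |: S0) LV' _ _)); last 2 first.
  - by rewrite finset.subUset finset.sub1set iV.
  - by apply/finset.set0Pn; exists i; rewrite finset.setU11.
  by move=> x; rewrite big_cons -(indM S0 i)//; ring.
(* Same expansion with no element removed yet: only the cone on [V] itself,
   which is not simplicial, stays apart. *)
have telescope (L : seq 'I_m) : {subset L <= Vp} -> simplicial_combination V
    (fun x => cone_ind V x - cone_ind V x * \prod_(i <- L) (1 - cone_ind (V :\ i) x)).
  elim: L => [|i L IH] LV.
    apply: simplicial_combination_ext (simplicial_combination0 V) => x.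
    by rewrite big_nil mulr1 subrr.
  have iV : i \in Vp by apply: LV; rewrite mem_head.
  have LV' : {subset L <= Vp} by move=> j jL; apply: LV; rewrite inE jL orbT.
  apply: simplicial_combination_ext (simplicial_combinationD 1 (IH LV')
    (simpl_part L [set i]%SET LV' _ _)); last 2 first.
  - by rewrite finset.sub1set.
  - by apply/finset.set0Pn; exists i; rewrite finset.set11.
  move=> x; rewrite big_cons.
  have := indM finset.set0 i x (finset.sub0set _) iV; rewrite finset.setD0 finset.setU0 => E.
  by rewrite -[in LHS]E; ring.
apply: simplicial_combination_ext (telescope (enum Vp) _); last first.
  by move=> i; rewrite mem_enum.
move=> x; rewrite big_enum /=; have [/asboolP Vx|Vx] := boolP `[< cone V x >]; last first.
  by rewrite /cone_ind (negPf Vx) mul0r subr0.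
have [i iV ix] := cover x Vx.
by rewrite (bigD1 i)//= [X in 1 - X]/cone_ind asboolT// subrr mul0r mulr0 subr0.
Qed.

Lemma cone_simplicial_combination (S : {set 'I_m}) : S != finset.set0 ->
  simplicial_combination S (cone_ind S).
Proof.
move: {2}#|S| (erefl #|S|) => k; elim: k S => [|k IH] S.
  by move/eqP; rewrite cards_eq0 => /eqP->; rewrite eqxx.
move=> cS /finset.set0Pn[w wS]; pose T := S :\ w.
have SE : S = w |: T by rewrite finset.setD1K.
have wT : w \notin T by rewrite !inE eqxx.
have [T0|T0] := eqVneq T finset.set0.
  rewrite SE T0; apply: cone_circuit; first by rewrite inE.
  move=> y y0 _; apply/rowP => i; rewrite mxE; apply: y0.
  by rewrite inE.
have [|c [Hc HT]] := IH T _ T0.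
  by move: cS; rewrite (cardsD1 w) wS => -[].
have HT' : forall U0, c U0 != 0 -> U0 \subset T by move=> U0 /Hc[].
have := cone_ind_adjoin HT' wT HT; rewrite -SE => HS.
apply: simplicial_combination_ext (fun x => esym (HS x)) _.
apply: simplicial_combination_sum => U0 /Hc[U0T U00 U0i].
have [c' [Hc' HU]] := cone_circuit (contra (fintype.subsetP U0T w) wT) U0i.
exists c'; split=> // A /Hc'[AU A0 Ai]; split=> //.
by rewrite (fintype.subset_trans AU)// SE finset.setUS.
Qed.

End Cones.

(** * Counting lattice points: Ehrhart's theorem *)

Lemma card_fset_sum (R : pzSemiRingType) (T : choiceType) (A B : {fset T}) :
  {subset A <= B} -> #|` A|%fset%:R = \sum_(z <- B) (z \in A)%:R :> R.
Proof.
move=> AB; rewrite -natr_sum; congr (_%:R).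
transitivity (count [in A] B); last first.
  by rewrite -sum1_count big_mkcond; apply: eq_bigr => z _; case: (z \in A).
rewrite -size_filter; apply: perm_size; apply: uniq_perm.
- exact: fset_uniq.
- exact/filter_uniq/fset_uniq.
move=> z; rewrite mem_filter /=; case: (boolP (z \in A)) => // /AB ->.
by [].
Qed.

Lemma finite_int_box (N : nat) (M : nat) :
  finite_set [set z : 'rV[int]_N | forall k, (`|(z 0 k)%R| <= M)%N].
Proof.
pose F (f : {ffun 'I_N -> 'I_(M + M).+1}) : 'rV[int]_N :=
  \row_k ((f k)%:Z - M%:Z).
apply: (sub_finite_set (B := F @` setT)); last first.
  exact/finite_image/finite_finset.
move=> z /= Hz; pose h k := `|(z 0 k + M%:Z)%R|%N.
have hE k : (h k)%:Z = z 0 k + M%:Z by have := Hz k; rewrite /h; lia.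
have hM k : (h k < (M + M).+1)%N by have := Hz k; have := hE k; lia.
exists [ffun k => Ordinal (hM k)] => //.
by apply/rowP => k; rewrite mxE ffunE /= hE addrK.
Qed.

Section LatticeSlices.
Variables (R : realType) (N m : nat) (Uz : 'M[int]_(m, N)).
Let U : 'M[R]_(m, N) := map_mx intr Uz.
Implicit Types S T D : {set 'I_m}.

(** In degree [n] and for independent [S], this interpolates between the whole cone,
    [D] empty, and the half-open fundamental parallelepiped, [D = S]. *)
Definition lattice_slice S D (n : nat) : set 'rV[int]_N :=
  [set z | exists y, [/\ cone_weights U S (map_mx intr z) y,
                         forall i, i \in D -> y 0 i < 1
                       & \sum_i y 0 i = n%:R]].

Lemma lattice_slice_finite S D n : finite_set (lattice_slice S D n).
Proof.
pose M := (\sum_i \sum_k `|Uz i k|)%N.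
apply: sub_finite_set (@finite_int_box N (n * M)).
move=> z [y [[y0 _ yz] _ yn]] k /=.
have : (`|(z 0 k)%R|%N%:R : R) <= (n * M)%N%:R; last by rewrite ler_nat.
rewrite natr_absz intr_norm.
have <- : (y *m U) 0 k = (z 0 k)%:~R by rewrite yz mxE.
rewrite mxE; apply: le_trans (ler_norm_sum _ _ _) _.
rewrite natrM -yn mulr_suml; apply: ler_sum => i _.
rewrite normrM ger0_norm//; apply: ler_wpM2l => //.
rewrite mxE -intr_norm -natr_absz ler_nat /M (bigD1 i)//= (bigD1 k)//=.
by rewrite -addnA leq_addr.
Qed.

(** The degree is a sum of [#|T|] weights below 1. *)
Lemma lattice_slice_full T n : T != finset.set0 -> (#|T| <= n)%N ->
  lattice_slice T T n = set0.
Proof.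
move=> /finset.set0Pn[j jT] Tn; apply/seteqP; split=> // z [y [[y0 yT _] y1 yn]].
have : \sum_i y 0 i < \sum_(i in T) 1.
  rewrite (bigID (mem T))/= [X in _ + X]big1; last by move=> i /yT.
  rewrite addr0 (bigD1 j)//= [ltRHS](bigD1 j)//=.
  apply: ltr_leD; first exact: y1.
  by apply: ler_sum => i /andP[/y1/ltW].
by rewrite sumr_const yn ltr_nat ltnNge Tn.
Qed.

(** A point whose weight at [j] is at least 1 is the translate by the generator [j]
    of a point of one degree less; independence makes this exclusive. *)
Lemma card_lattice_sliceS T D j n : independent U T -> j \in T -> j \notin D ->
  #|` fset_set (lattice_slice T D n.+1)|%fset =
  (#|` fset_set (lattice_slice T (j |: D) n.+1)|%fset +
   #|` fset_set (lattice_slice T D n)|%fset)%N.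
Proof.
move=> Ti jT jD; pose sh (z : 'rV[int]_N) := z + row j Uz.
have shE z : map_mx intr (sh z) = map_mx intr z + row j U :> 'rV[R]_N.
  by rewrite map_mxD map_row.
have deltaU : delta_mx 0 j *m U = row j U by rewrite rowE.
have delta_sum : \sum_i (delta_mx 0 j : 'rV[R]_m) 0 i = 1.
  rewrite (bigD1 j)//= mxE !eqxx big1 ?addr0// => i /negPf ij.
  by rewrite mxE ij andbF.
have AE : lattice_slice T D n.+1 =
    lattice_slice T (j |: D) n.+1 `|` sh @` lattice_slice T D n.
  apply/seteqP; split=> z.
    move=> [y [[y0 yT yz] yD yn]]; have [yj|yj] := ltP (y 0 j) 1.
      left; exists y; split=> // i; rewrite !inE => /orP[/eqP->//|]; exact: yD.
    right; exists (z - row j Uz); last by rewrite /sh subrK.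
    exists (y - delta_mx 0 j); split; first split.
    - move=> i; rewrite !mxE eqxx; have [->|_] := eqVneq; first by rewrite subr_ge0.
      by rewrite subr0.
    - move=> i iT; rewrite !mxE eqxx yT//; have [ij|_] := eqVneq; last by rewrite subr0.
      by move: iT; rewrite ij jT.
    - by rewrite mulmxBl deltaU yz map_mxB map_row.
    - move=> i iD; rewrite !mxE eqxx; have [ij|_] := eqVneq; last by rewrite subr0 yD.
      by move: jD; rewrite -ij iD.
    - under eq_bigr do rewrite mxE [X in _ + X]mxE.
      by rewrite sumrB yn delta_sum -natr1 addrK.
  move=> [[y [Hy yD yn]]|[z' [y [[y0 yT yz] yD yn]] <-]].
    by exists y; split=> // i iD; apply: yD; rewrite !inE iD orbT.
  exists (y + delta_mx 0 j); split; first split.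
  - by move=> i; rewrite !mxE addr_ge0.
  - move=> i iT; rewrite !mxE yT// eqxx; have [ij|_] := eqVneq; last by rewrite add0r.
    by move: iT; rewrite ij jT.
  - by rewrite mulmxDl deltaU yz shE.
  - move=> i iD; rewrite !mxE eqxx; have [ij|_] := eqVneq; last by rewrite addr0 yD.
    by move: jD; rewrite -ij iD.
  - under eq_bigr do rewrite mxE.
    by rewrite big_split/= yn delta_sum natr1.
have disj : lattice_slice T (j |: D) n.+1 `&` sh @` lattice_slice T D n = set0.
  apply/seteqP; split=> // z [[y [[y0 yT yz] yD yn]]] [z' [y' [[y'0 y'T y'z] y'D y'n]] zz'].
  have E : y - delta_mx 0 j - y' = 0.
    apply: Ti => [i iT|].
      rewrite !mxE yT// y'T// eqxx; have [ij|_] := eqVneq; last by rewrite !subr0.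
      by move: iT; rewrite ij jT.
    rewrite !mulmxBl deltaU yz y'z -zz' shE.
    by rewrite addrK subrr.
  have := congr1 (fun M : 'rV_m => M 0 j) E; rewrite !mxE !eqxx /= mulr1n => {}E.
  have := yD j; rewrite !inE eqxx => /(_ isT); have := y'0 j; lra.
have fin := lattice_slice_finite.
rewrite AE fset_setU//; last exact: finite_image.
rewrite cardfsU -fset_setI//; last exact: finite_image.
rewrite disj fset_set0 cardfs0 subn0 fset_set_image// card_imfset//.
by move=> a b /addIr.
Qed.

(** Restricting one weight less costs one summation over [n] and gains one index
    in the range [#|D| <= n]; when [D] is empty the range is everything. *)
Lemma lattice_slice_poly T D : T != finset.set0 -> independent U T -> D \subset T ->
  exists g : {poly R}, forall n, (#|D| <= n)%N ->
    #|` fset_set (lattice_slice T D n)|%fset%:R = g.[n%:R].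
Proof.
move=> T0 Ti; move: {2}#|T :\: D| (erefl #|T :\: D|) => k.
elim: k D => [|k IH] D kE DT.
  exists 0 => n; rewrite horner0; have -> : D = T.
    by apply/eqP; rewrite finset.eqEsubset DT -finset.setD_eq0 -cards_eq0 kE.
  by move=> Tn; rewrite lattice_slice_full// fset_set0 cardfs0.
have [j] : exists j, j \in T :\: D.
  by apply/finset.set0Pn; rewrite -cards_eq0 kE.
rewrite finset.in_setD => /andP[jD jT].
have kE' : #|T :\: (j |: D)| = k.
  have := cardsD1 j (T :\: D); rewrite finset.in_setD jD jT kE => -[->].
  by rewrite finset.setDDl finset.setUC.
have DjT : j |: D \subset T by rewrite finset.subUset finset.sub1set jT.
have [g Hg] := IH _ kE' DjT.
have [G HG] := discrete_antiderivative g.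
pose a n : R := #|` fset_set (lattice_slice T D n)|%fset%:R.
exists (G + (a #|D| - G.[#|D|%:R])%:P) => n Dn.
have {Dn} [i ->] : exists i, n = (#|D| + i)%N by exists (n - #|D|)%N; lia.
elim: i => [|i IHi]; first by rewrite addn0 hornerD hornerC addrC subrK.
rewrite addnS (card_lattice_sliceS _ Ti jT jD) natrD IHi Hg; last first.
  by rewrite cardsU1 jD /=; lia.
by rewrite -HG -natr1 !hornerD !hornerC addrK addrA subrK.
Qed.

Variable delta : 'cV[R]_N.
Hypothesis degU : U *m delta = const_mx 1.

Lemma card_lattice_slice_poly S : S != finset.set0 ->
  exists g : {poly R}, forall n,
    #|` fset_set (lattice_slice S finset.set0 n)|%fset%:R = g.[n%:R].
Proof.
move=> S0; have [c [Hc HS]] := cone_simplicial_combination degU S0.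
have /choice[g Hg] : forall T, exists g : {poly R}, c T != 0 -> forall n,
    #|` fset_set (lattice_slice T finset.set0 n)|%fset%:R = g.[n%:R].
  move=> T; have [_|/Hc[_ T0 Ti]] := eqVneq (c T) 0; first by exists 0.
  have [g Hg] := lattice_slice_poly T0 Ti (finset.sub0set T).
  by exists g => _ n; rewrite Hg// cards0.
exists (\sum_T c T *: g T) => n; rewrite horner_sum.
pose B := fset_set (lattice_slice S finset.set0 n).
have BE z : z \in B = `[< lattice_slice S finset.set0 n z >].
  by rewrite in_fset_set ?inE//; exact: lattice_slice_finite.
rewrite (@card_fset_sum R _ B B)//.
transitivity (\sum_(z <- B) cone_ind U S (map_mx intr z)).
  apply: eq_big_seq => z zB.
  have := zB; rewrite {1}BE => /asboolP[y [Hy _ _]].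
  by rewrite zB /cone_ind asboolT//; exists y.
under eq_bigr do rewrite HS.
rewrite exchange_big; apply: eq_bigr => T _; rewrite -mulr_sumr !hornerE.
have [->|cT] := eqVneq (c T) 0; first by rewrite !mul0r.
rewrite -Hg//; congr (_ * _); have [TS _ _] := Hc T cT.
have TB : {subset fset_set (lattice_slice T finset.set0 n) <= B}.
  move=> z; rewrite BE in_fset_set ?inE//; last exact: lattice_slice_finite.
  move=> [y [[y0 yT yz] yD yn]]; exists y; split=> //; split=> // i iS.
  by rewrite yT// (contra (fintype.subsetP TS i)).
rewrite (card_fset_sum _ TB); apply: eq_big_seq => z zB.
have := zB; rewrite {1}BE => /asboolP[y [Hy _ yn]].
congr (_%:R); congr nat_of_bool; rewrite in_fset_set; last exact: lattice_slice_finite.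
apply/asboolP/idP; rewrite inE.
  move=> [y' Hy']; exists y'; split=> //; first by move=> i; rewrite inE.
  by rewrite (sum_cone_weights degU Hy') -(sum_cone_weights degU Hy).
by move=> [y' [Hy' _ _]]; exists y'.
Qed.

End LatticeSlices.

(** The vertices are lifted to height 1, so that degree [n] of the cone is the
    dilate by [n].  For [n = 0] both consist of the origin alone. *)
Lemma lattice_polytope_ehrhart_poly (R : realType) (N : nat) (Q : set 'rV[R]_N) :
  lattice_polytope Q ->
  exists g : {poly R}, forall n, (ehrhart Q n)%:R = g.[n%:R] :> R.
Proof.
move=> [k [u {Q}->]].
pose Uz : 'M[int]_(k.+1, N + 1) := \matrix_i row_mx (u i) (const_mx 1).
pose delta : 'cV[R]_(N + 1) := col_mx 0 (const_mx 1).
have UE : map_mx intr Uz = row_mx (\matrix_i map_mx intr (u i)) (const_mx 1) :> 'M[R]_(k.+1, N + 1).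
  apply/row_matrixP => i; rewrite -map_row rowK map_row_mx row_row_mx rowK.
  by congr row_mx; rewrite map_const_mx row_const.
have degU : map_mx intr Uz *m delta = const_mx 1.
  rewrite UE mul_row_col mulmx0 add0r; apply/matrixP => i j.
  by rewrite !mxE big_ord1 !mxE mulr1.
have [|g Hg] := card_lattice_slice_poly degU (S := [set: 'I_k.+1]%SET).
  by apply/finset.set0Pn; exists ord0.
exists g => n; rewrite -Hg /ehrhart; congr (_%:R).
set Q := convex_hull _.
pose h (a : 'rV[int]_N) : 'rV[int]_(N + 1) := row_mx a (const_mx n%:Z).
have hinj : injective h by move=> a b /eq_row_mx[].
have hE : lattice_slice R Uz [set: 'I_k.+1]%SET finset.set0 n =
    h @` dilate_lattice_points Q n.
  apply/seteqP; split=> z.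
    move=> [y [[y0 _ yz] _ yn]]; exists (lsubmx z).
      move: yz; rewrite UE mul_mx_row -[in RHS](hsubmxK z) map_row_mx => /eq_row_mx[yl yr].
      case: n @h hinj yn => [|n] h hinj yn.
        exists (map_mx intr (u ord0)).
          exists (fun i => (i == ord0)%:R); split=> [i||]; first exact: ler0n.
            by rewrite (bigD1 ord0)//= big1 ?addr0// => i /negPf->.
          rewrite (bigD1 ord0)//= scale1r big1 ?addr0// => i /negPf->.
          by rewrite scale0r.
        rewrite -yl scale0r mulmx_sum_row big1// => i _.
        suff -> : y 0 i = 0 by rewrite scale0r.
        apply/eqP; move/eqP: yn; rewrite psumr_eq0// => /allP; apply.
        by rewrite mem_index_enum.
      exists (n.+1%:R^-1 *: lsubmx (map_mx intr z)).
        exists (fun i => n.+1%:R^-1 * y 0 i); split=> [i||].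
        - by rewrite mulr_ge0// invr_ge0.
        - by rewrite -mulr_sumr yn mulVf// pnatr_eq0.
        - rewrite -map_lsubmx -yl mulmx_sum_row scaler_sumr; apply: eq_bigr => i _.
          by rewrite rowK scalerA.
      by rewrite scalerA divff ?pnatr_eq0// scale1r map_lsubmx.
    rewrite /h -[RHS]hsubmxK; congr row_mx; apply/matrixP => i j.
    move: yz; rewrite UE mul_mx_row -[in RHS](hsubmxK z) map_row_mx => /eq_row_mx[_ yr].
    apply: (@intr_inj R); rewrite !ord1 !mxE.
    have := congr1 (fun M : 'rV_1 => M 0 0) yr; rewrite !mxE => <-.
    rewrite -[LHS]/(n%:R) -yn; apply: eq_bigr => t _; by rewrite mxE mulr1.
  move=> [a [x [w [w0 w1 ->]] ax] <-]; exists (\row_i (n%:R * w i)); split.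
  - split=> [i|i|]; first by rewrite mxE mulr_ge0.
      by rewrite inE.
    rewrite UE mul_mx_row map_row_mx ax map_const_mx; congr row_mx.
      rewrite mulmx_sum_row scaler_sumr; apply: eq_bigr => i _.
      by rewrite rowK mxE scalerA.
    apply/matrixP => i j; rewrite !mxE; transitivity (n%:R * \sum_t w t).
      by rewrite mulr_sumr; apply: eq_bigr => t _; rewrite !mxE mulr1.
    by rewrite w1 mulr1.
  - by move=> i; rewrite inE.
  - under eq_bigr do rewrite mxE.
    by rewrite -mulr_sumr w1 mulr1.
have fin : finite_set (dilate_lattice_points Q n).
  have := lattice_slice_finite R Uz [set: 'I_k.+1]%SET finset.set0 n.
  rewrite hE => /(finite_preimage (f := h)) H.
  by apply: sub_finite_set (H (in2W hinj)) => a Qa; exists a.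
by rewrite hE fset_set_image// card_imfset.
Qed.

(** * Prisms, and weighted sums as combinations of Ehrhart polynomials *)

Definition nat_polytope (R : realType) (s m : nat) (v : 'I_m -> 'rV[nat]_s) :
    set 'rV[R]_s :=
  convex_hull (fun j => map_mx (fun k : nat => k%:R) (v j)).

Section NatPolytope.
Variables (R : realType) (s k : nat) (v : 'I_k.+1 -> 'rV[nat]_s).
Let P : set 'rV[R]_s := nat_polytope v.

Lemma nat_polytope_lattice : lattice_polytope P.
Proof.
exists k, (fun j => map_mx Posz (v j)); rewrite /P /nat_polytope; congr convex_hull.
by apply/funext => j; apply/rowP => i; rewrite !mxE.
Qed.

Lemma nat_polytope_bound x i : P x ->
  0 <= x 0 i <= (\sum_j v j ord0 i)%N%:R.
Proof.
move=> [w [w0 w1 ->]]; rewrite summxE; apply/andP; split.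
  by apply: sumr_ge0 => j _; rewrite !mxE mulr_ge0.
rewrite natr_sum; apply: ler_sum => j _; rewrite !mxE ler_piMl//.
by rewrite -w1 (bigD1 j)//= lerDl sumr_ge0.
Qed.

Lemma dilate_ge0 n a i : dilate_lattice_points P n a -> 0 <= a 0 i.
Proof.
move=> [x /(nat_polytope_bound i)/andP[x0 _] ax].
have := congr1 (fun M : 'rV_s => M 0 i) ax; rewrite !mxE => E.
by rewrite -(ler0z R) E mulr_ge0.
Qed.

Lemma dilate_le n a i : dilate_lattice_points P n a ->
  (`|(a 0 i)%R| <= n * \sum_j v j ord0 i)%N.
Proof.
move=> Ha; have a0 := dilate_ge0 i Ha; case: Ha => x /(nat_polytope_bound i)/andP[_ x1] ax.
have := congr1 (fun M : 'rV_s => M 0 i) ax; rewrite !mxE => E.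
rewrite -(ler_nat R) natr_absz ger0_norm// E natrM ler_wpM2l//.
Qed.

Lemma finite_dilate n : finite_set (dilate_lattice_points P n).
Proof.
pose M := (\sum_i n * \sum_j v j ord0 i)%N.
apply: sub_finite_set (@finite_int_box s M) => a Ha i /=.
apply: (leq_trans (dilate_le i Ha)).
by rewrite /M (bigD1 i)//= leq_addr.
Qed.

Definition dilate_fset n := fset_set (dilate_lattice_points P n).

Lemma in_dilate_fset n a : a \in dilate_fset n <-> dilate_lattice_points P n a.
Proof. by rewrite in_fset_set ?inE//; exact: finite_dilate. Qed.

Lemma dilate_fset_abs n a i : a \in dilate_fset n -> a 0 i = (`|a ord0 i|)%N%:Z.
Proof. by move=> /in_dilate_fset/(dilate_ge0 i) ai; rewrite gez0_abs. Qed.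

(** Vertices of the prism between the graphs of [0] and [x_i] over the polytope. *)
Definition prism_vertices (i : 'I_s) (j : 'I_(k.+1 + k.+1)) : 'rV[nat]_(s + 1) :=
  match fintype.split j with
  | inl j => row_mx (v j) (const_mx 0%N)
  | inr j => row_mx (v j) (const_mx (v j ord0 i))
  end.

(** Over [x = sum_j w_j v_j], the height [y = t x_i] is reached by splitting each
    weight [w_j] into [(1 - t) w_j] below and [t w_j] above. *)
Lemma prismP (i : 'I_s) (x : 'rV[R]_s) (y : R) :
  nat_polytope (prism_vertices i) (row_mx x (const_mx y)) <->
  P x /\ 0 <= y <= x 0 i.
Proof.
pose V j : 'rV[R]_s := map_mx (fun k : nat => k%:R) (v j).
pose V' j : 'rV[R]_(s + 1) := map_mx (fun k : nat => k%:R) (prism_vertices i j).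
have V'l j : V' (lshift k.+1 j) = row_mx (V j) (const_mx 0).
  by rewrite /V' /prism_vertices (unsplitK (inl j)) map_row_mx map_const_mx.
have V'r j : V' (rshift k.+1 j) = row_mx (V j) (const_mx (V j 0 i)).
  rewrite /V' /prism_vertices (unsplitK (inr j)) map_row_mx map_const_mx.
  by rewrite mxE.
split.
  move=> [w [w0 w1]]; rewrite big_split_ord/= => E.
  have {}E : row_mx x (const_mx y) =
      row_mx (\sum_j (w (lshift _ j) + w (rshift _ j)) *: V j)
             (const_mx (\sum_j w (rshift _ j) * V j 0 i)) :> 'rV[R]_(s + 1).
    rewrite E (eq_bigr (fun j => row_mx (w (lshift k.+1 j) *: V j) 0)); last first.
      move=> j _; rewrite -/(V' _) V'l scale_row_mx; congr row_mx.
      by apply/matrixP => a b; rewrite !mxE mulr0.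
    rewrite [X in _ + X](eq_bigr (fun j => row_mx (w (rshift k.+1 j) *: V j)
        (const_mx (w (rshift k.+1 j) * V j 0 i)))); last first.
      move=> j _; rewrite -/(V' _) V'r scale_row_mx; congr row_mx.
      by apply/matrixP => a b; rewrite !mxE.
    apply/rowP => a; rewrite !mxE !summxE; case: splitP => b ab.
      rewrite summxE -big_split; apply: eq_bigr => j _ /=.
      have -> : a = lshift 1 b by apply: val_inj.
      by rewrite !row_mxEl [RHS]mxE mulrDl !mxE.
    have -> : a = rshift s b by apply: val_inj.
    rewrite mxE big1 ?add0r; last by move=> j _; rewrite row_mxEr mxE.
    by apply: eq_bigr => j _; rewrite row_mxEr !mxE.
  move/eq_row_mx: E => [-> /(congr1 (fun M : 'rV_1 => M 0 0))]; rewrite !mxE => ->.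
  have V0 j : 0 <= V j 0 i by rewrite mxE.
  split.
    exists (fun j => w (lshift _ j) + w (rshift _ j)); split=> //.
      by move=> j; rewrite addr_ge0.
    by rewrite big_split -w1 big_split_ord.
  rewrite sumr_ge0 => [|j _]; last by rewrite mulr_ge0.
  rewrite summxE; apply: ler_sum => j _; rewrite [leRHS]mxE mulrDl lerDr.
  exact: mulr_ge0.
move=> [[w [w0 w1 xE]] /andP[y0 yx]].
pose t := y / x 0 i.
have yt : y = t * x 0 i.
  have [xi|xi] := eqVneq (x 0 i) 0; last by rewrite divfK.
  by rewrite xi mulr0; apply/le_anti; rewrite y0 -xi yx.
have x0 : 0 <= x 0 i by exact: le_trans yx.
have t0 : 0 <= t by rewrite divr_ge0.
have t1 : t <= 1.
  have [xi|xi] := eqVneq (x 0 i) 0; first by rewrite /t xi invr0 mulr0.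
  by rewrite ler_pdivrMr ?mul1r// lt_neqAle eq_sym xi.
exists (fun j => match fintype.split j with inl j => (1 - t) * w j | inr j => t * w j end).
have sl (j : 'I_k.+1) : fintype.split (lshift k.+1 j) = inl j by exact: (unsplitK (inl j)).
have sr (j : 'I_k.+1) : fintype.split (rshift k.+1 j) = inr j by exact: (unsplitK (inr j)).
split.
- by move=> j; case: (fintype.split j) => a; rewrite mulr_ge0// subr_ge0.
- rewrite big_split_ord/= -[RHS]w1 -big_split; apply: eq_bigr => j _ /=.
  by rewrite sl sr -mulrDl subrK mul1r.
- rewrite big_split_ord/= -big_split/=.
  rewrite (eq_bigr (fun j => row_mx (w j *: V j) (const_mx (t * (w j * V j 0 i))))).
    apply/rowP => a; rewrite summxE; case: (split_ordP a) => b ->.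
      rewrite row_mxEl xE summxE; apply: eq_bigr => j _.
      by rewrite row_mxEl.
    rewrite row_mxEr mxE yt xE summxE mulr_sumr; apply: eq_bigr => j _.
    by rewrite row_mxEr !mxE.
  move=> j _; rewrite sl sr -/(V' _) -/(V' _) V'l V'r !scale_row_mx add_row_mx.
  congr row_mx; first by rewrite -scalerDl -mulrDl subrK mul1r.
  by apply/matrixP => a b; rewrite !mxE; ring.
Qed.

End NatPolytope.

Section PrismSum.
Variables (R : realType) (s k : nat) (v : 'I_k.+1 -> 'rV[nat]_s).

Lemma dilate_prism (i : 'I_s) n (a : 'rV[int]_s) (b : int) :
  dilate_lattice_points (nat_polytope (prism_vertices v i) : set 'rV[R]_(s + 1)) n
    (row_mx a (const_mx b)) <->
  dilate_lattice_points (nat_polytope v : set 'rV[R]_s) n a /\ 0 <= b <= a 0 i.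
Proof.
have mE : map_mx intr (row_mx a (const_mx b : 'rV_1)) =
    row_mx (map_mx intr a) (const_mx b%:~R) :> 'rV[R]_(s + 1).
  by rewrite map_row_mx map_const_mx.
have cE (y : 'rV[R]_1) : y = const_mx (y 0 0).
  by apply/rowP => j; rewrite ord1 mxE.
split.
  move=> [z]; rewrite -[z]hsubmxK (cE (rsubmx z)) => /prismP[Px /andP[y0 yx]].
  rewrite mE scale_row_mx => /eq_row_mx[ax /(congr1 (fun M : 'rV_1 => M 0 0)) bE].
  split; first by exists (lsubmx z).
  move: bE; rewrite mxE [RHS]mxE [X in _ * X]mxE => bE.
  have aE := congr1 (fun M : 'rV_s => M 0 i) ax; rewrite mxE [RHS]mxE in aE.
  by rewrite -(ler0z R) -(ler_int R) bE aE mulr_ge0// ler_wpM2l.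
move=> [[x Px ax] /andP[b0 ba]].
have aE := congr1 (fun M : 'rV_s => M 0 i) ax; rewrite mxE [RHS]mxE in aE.
case: n ax aE => [|n] ax aE.
  have /andP[x0 _] := nat_polytope_bound i Px.
  exists (row_mx x (const_mx 0)); first by apply/prismP; rewrite lexx.
  rewrite mE scale_row_mx ax; congr row_mx; apply/matrixP => j l; rewrite !mxE mul0r.
  have a0 : a 0 i = 0 by apply/eqP; rewrite -(intr_eq0 R) aE mul0r.
  have : b = 0 by lia.
  by move->.
have n0 : 0 < n.+1%:R :> R by rewrite ltr0n.
exists (row_mx x (const_mx (b%:~R / n.+1%:R))).
  apply/prismP; split=> //; apply/andP; split.
    by rewrite divr_ge0// ler0z.
  by rewrite ler_pdivrMr// mulrC -aE ler_int.
rewrite mE scale_row_mx ax; congr row_mx; apply/matrixP => j l; rewrite !mxE.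
by rewrite mulrC divfK// gt_eqF.
Qed.

Lemma sum_dilate_prism (i : 'I_s) n (F : 'rV[int]_s -> nat) :
  (\sum_(z <- dilate_fset R (prism_vertices v i) n) F (lsubmx z) =
   \sum_(a <- dilate_fset R v n) F a * `|(a 0 i)%R|.+1)%N.
Proof.
rewrite (perm_big [seq row_mx a (const_mx b%:Z) | a <- dilate_fset R v n,
                      b <- iota 0 `|(a ord0 i)%R|.+1]); last first.
  apply: uniq_perm; first exact: fset_uniq.
    apply: allpairs_uniq_dep; first exact: fset_uniq.
      by move=> a _; exact: iota_uniq.
    move=> [a b] [a' b'] _ _ /= /eq_row_mx[-> /(congr1 (fun M : 'rV_1 => M 0 0))].
    by rewrite !mxE => -[->].
  move=> z; apply/idP/allpairsPdep.
    move=> /in_dilate_fset; rewrite -[z]hsubmxK.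
    have -> : rsubmx z = const_mx (rsubmx z 0 0).
      by apply/rowP => j; rewrite ord1 [RHS]mxE.
    move=> /dilate_prism[Ha /andP[b0 ba]].
    exists (lsubmx z), `|(rsubmx z ord0 ord0)%R|%N; split.
    - exact/in_dilate_fset.
    - rewrite mem_iota leq0n add0n ltnS -lez_nat (gez0_abs (le_trans b0 ba)).
      by rewrite (gez0_abs b0).
    - by rewrite gez0_abs.
  move=> [a [b [/in_dilate_fset Ha]]]; rewrite mem_iota => bi ->.
  apply/in_dilate_fset/dilate_prism; split=> //.
  rewrite -[a 0 i]gez0_abs ?(dilate_ge0 i Ha)// lez_nat.
rewrite big_allpairs_dep; apply: eq_bigr => a _.
under eq_bigr do rewrite row_mxKl.
by rewrite big_const_seq count_predT size_iota iter_addn_0.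
Qed.

End PrismSum.

Lemma sum_succ_prod_ehrhart (R : realType) (s k : nat) (v : 'I_k.+1 -> 'rV[nat]_s)
    (l : seq 'I_s) :
  ehrhart_polynomial R (fun n =>
    \sum_(a <- dilate_fset R v n) \prod_(i <- l) `|(a 0%R i)%R|.+1)%N.
Proof.
move: {2}(size l) (erefl (size l)) => L.
elim: L s k v l => [|L IH] s k v [|i l]//=.
  move=> _; exists s, (nat_polytope v); split; first exact: nat_polytope_lattice.
  apply/funext => n; under eq_bigr do rewrite big_nil.
  by rewrite sum1_size.
move=> [lL].
have [|N [Q [HQ QE]]] := IH _ _ (prism_vertices v i) (map (lshift 1) l).
  by rewrite size_map.
exists N, Q; split=> //; rewrite -QE; apply/funext => n.
transitivity (\sum_(z <- dilate_fset R (prism_vertices v i) n)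
    \prod_(j <- l) `|(lsubmx z 0%R j)%R|.+1)%N; last first.
  apply: eq_bigr => z _; rewrite big_map.
  by apply: eq_bigr => j _; rewrite mxE.
rewrite (sum_dilate_prism R v i n (fun a => \prod_(j <- l) `|(a 0%R j)%R|.+1)%N).
by apply: eq_bigr => a _; rewrite big_cons mulnC.
Qed.

Definition ehrhart_span (R : realType) (K : fieldType) (E : nat -> K) : Prop :=
  exists (r : nat) (c : 'I_r -> K) (e : 'I_r -> nat -> nat),
    (forall i, ehrhart_polynomial R (e i)) /\
    forall n, E n = \sum_i c i * (e i n)%:R.

Section EhrhartSpan.
Variables (R : realType) (K : fieldType).
Implicit Types E : nat -> K.

Lemma ehrhart_span_ext E E' : E =1 E' -> ehrhart_span R E -> ehrhart_span R E'.
Proof. by move=> EE' [r [c [e [He HE]]]]; exists r, c, e; split=> // n; rewrite -EE'. Qed.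

Lemma ehrhart_span1 (e : nat -> nat) :
  ehrhart_polynomial R e -> ehrhart_span R (fun n => (e n)%:R : K).
Proof.
by move=> He; exists 1%N, (fun=> 1), (fun=> e); split=> // n; rewrite big_ord1 mul1r.
Qed.

Lemma ehrhart_span0 : ehrhart_span R (fun=> 0 : K).
Proof.
exists 0%N, (fun=> 0), (fun=> fun=> 0%N); split=> [[]//|n].
by rewrite big_ord0.
Qed.

Lemma ehrhart_spanD b E E' : ehrhart_span R E -> ehrhart_span R E' ->
  ehrhart_span R (fun n => E n + b * E' n).
Proof.
move=> [r [c [e [He HE]]]] [r' [c' [e' [He' HE']]]].
exists (r + r')%N,
  (fun i => match fintype.split i with inl j => c j | inr j => b * c' j end),
  (fun i => match fintype.split i with inl j => e j | inr j => e' j end).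
split=> [i|n]; first by case: (fintype.split i).
rewrite big_split_ord/= HE HE' mulr_sumr; congr (_ + _); apply: eq_bigr => j _.
  by rewrite (unsplitK (inl j)).
by rewrite (unsplitK (inr j)) mulrA.
Qed.

Variables (s k : nat) (v : 'I_k.+1 -> 'rV[nat]_s).

Lemma ehrhart_span_prod (l l' : seq 'I_s) :
  ehrhart_span R (fun n => (\sum_(a <- dilate_fset R v n)
    (\prod_(i <- l) `|(a 0%R i)%R|) * (\prod_(i <- l') `|(a 0%R i)%R|.+1))%N%:R : K).
Proof.
elim: l l' => [|i l IH] l'.
  apply: ehrhart_span_ext (ehrhart_span1 (sum_succ_prod_ehrhart R v l')) => n.
  by congr (_%:R); apply: eq_bigr => a _; rewrite big_nil mul1n.
apply: ehrhart_span_ext (ehrhart_spanD (-1) (IH (i :: l')) (IH l')) => n.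
rewrite mulN1r -natrB.
  congr (_%:R); rewrite -sumnB; last first.
    by move=> a _; rewrite big_cons mulSn mulnDr leq_addr.
  apply: eq_bigr => a _; rewrite !big_cons mulSn mulnDr addKn; lia.
by apply: leq_sum => a _; rewrite big_cons mulSn mulnDr leq_addr.
Qed.

Definition monomial_sum (e : multinom s) (n : nat) : nat :=
  (\sum_(a <- dilate_fset R v n) \prod_i `|(a 0%R i)%R| ^ e i)%N.

Lemma ehrhart_span_monomial_sum e :
  ehrhart_span R (fun n => (monomial_sum e n)%:R : K).
Proof.
pose l := flatten [seq nseq (e i) i | i <- index_enum 'I_s].
apply: ehrhart_span_ext (ehrhart_span_prod l [::]) => n.
congr (_%:R); apply: eq_bigr => a _; rewrite big_nil muln1 big_flatten big_map.
by apply: eq_bigr => i _; rewrite big_nseq iter_muln_1.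
Qed.

Lemma weighted_ehrhartE (f : mpoly s K) n :
  weighted_ehrhart (nat_polytope v : set 'rV[R]_s) f n =
  \sum_(e <- msupp f) mcoeff e f * (monomial_sum e n)%:R.
Proof.
rewrite /weighted_ehrhart fsbig_finite/=; last exact: finite_dilate.
under eq_bigr do rewrite mevalE.
rewrite exchange_big/=; apply: eq_bigr => e _; rewrite -mulr_sumr; congr (_ * _).
rewrite natr_sum; apply: eq_big_seq => a aP; rewrite natr_prod; apply: eq_bigr => i _.
by rewrite natrX (dilate_fset_abs i aP).
Qed.

Lemma ehrhart_span_weighted (f : mpoly s K) :
  ehrhart_span R (weighted_ehrhart (nat_polytope v : set 'rV[R]_s) f).
Proof.
apply: ehrhart_span_ext (fun n => esym (weighted_ehrhartE f n)) _.
elim: (msupp f : seq _) => [|e l IH].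
  by apply: ehrhart_span_ext ehrhart_span0 => n; rewrite big_nil.
apply: ehrhart_span_ext (ehrhart_spanD (mcoeff e f) IH (ehrhart_span_monomial_sum e)) => n.
by rewrite big_cons addrC.
Qed.

End EhrhartSpan.

Lemma ehrhart_span_poly (R : realType) (E : nat -> R) :
  ehrhart_span R E -> exists g : {poly R}, represents g E.
Proof.
move=> [r [c [e [He HE]]]].
have /choice[g Hg] : forall i, exists g : {poly R}, forall n, (e i n)%:R = g.[n%:R].
  move=> i; have [N [Q [HQ ->]]] := He i; exact: lattice_polytope_ehrhart_poly.
exists (\sum_i c i *: g i) => n; rewrite HE horner_sum.
by apply: eq_bigr => i _; rewrite hornerZ Hg.
Qed.

(** * Upper and lower growth of monomial sums *)

Lemma leq_expn_base m n e : (m <= n)%N -> (m ^ e <= n ^ e)%N.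
Proof. by case: e => // e mn; rewrite leq_exp2r. Qed.

Lemma card_fset_le_inj (T : choiceType) (J : finType) (B : {fset T}) (h : T -> J) :
  {in B &, injective h} -> (#|` B|%fset <= #|J|)%N.
Proof.
move=> hinj; have U : uniq (map h B) by rewrite map_inj_in_uniq ?fset_uniq.
by rewrite -(size_map h) -(card_uniqP U) max_card.
Qed.

Lemma card_scale_le_sum (R : numDomainType) (T : choiceType) (J : finType)
    (B : {fset T}) (h : J -> T) (F : T -> R) (c : R) :
  injective h -> (forall j, h j \in B) -> (forall a, a \in B -> 0 <= F a) ->
  (forall j, c <= F (h j)) -> #|J|%:R * c <= \sum_(a <- B) F a.
Proof.
move=> hinj hB F0 cF; pose L := [seq h j | j <- enum J].
have UL : uniq L by rewrite map_inj_uniq// enum_uniq.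
have LB : perm_eq [seq x <- B | x \in L] L.
  apply: uniq_perm => //; first exact/filter_uniq/fset_uniq.
  move=> z; rewrite mem_filter /=; case: (boolP (z \in L)) => // /mapP[j _ ->].
  exact: hB.
rewrite -(perm_big _ (permEl (perm_filterC [in L] B))) big_cat/= (perm_big _ LB)/=.
rewrite big_map big_enum/= -[leLHS]addr0; apply: lerD.
  by rewrite mulr_natl -sumr_const; apply: ler_sum.
rewrite big_seq; apply: sumr_ge0 => a; rewrite mem_filter => /andP[_]; exact: F0.
Qed.

Section Growth.
Variables (R : realType) (s k : nat) (v : 'I_k.+1 -> 'rV[nat]_s).
Let P : set 'rV[R]_s := nat_polytope v.
Let V j : 'rV[R]_s := map_mx (fun k : nat => k%:R) (v j).
Let coord_bound := (\sum_i \sum_j v j ord0 i)%N.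

Lemma dilate_fset_le n a i : a \in dilate_fset R v n ->
  (`|(a 0 i)%R| <= n * coord_bound)%N.
Proof.
move=> /in_dilate_fset/(dilate_le i)/leq_trans; apply.
by rewrite leq_mul2l /coord_bound (bigD1 i)//= leq_addr orbT.
Qed.

Lemma affine_hull_sub (A : set 'rV[R]_s) : A `<=` affine_hull A.
Proof.
move=> x Ax; exists 1%N, (fun=> x), (fun=> 1).
by split=> //; rewrite big_ord1 ?scale1r.
Qed.

(** The direction space [U] of the affine hull is determined by [\rank U] of its
    coordinates, so lattice points of the dilate are determined by the same
    coordinates. *)
Lemma card_dilate_fset_le d n : has_dim P d ->
  (#|` dilate_fset R v n|%fset <= (n * coord_bound).+1 ^ d)%N.
Proof.
move=> [x0 [U [HU <-]]].
rewrite -mxrank_tr; pose f := maxrankfun U^T.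
have [D HD] : exists D, U^T = D *m rowsub f U^T.
  by apply/submxP; rewrite eq_maxrowsub.
pose h (a : 'rV[int]_s) : {ffun 'I_(\rank U^T) -> 'I_(n * coord_bound).+1} :=
  [ffun j => inord `|(a 0 (f j))%R|].
have := @card_fset_le_inj _ _ (dilate_fset R v n) h.
rewrite card_ffun !card_ord; apply=> a b aB bB hab.
have abf j : a 0 (f j) = b 0 (f j).
  have := congr1 (fun g : {ffun _ -> _} => val (g j)) hab.
  rewrite !ffunE /= !inordK ?ltnS ?dilate_fset_le// => E.
  by rewrite (dilate_fset_abs _ aB) (dilate_fset_abs _ bB) E.
have /in_dilate_fset[x Px ax] := aB; have /in_dilate_fset[y Py bY] := bB.
have Ux z : P z -> (z - x0 <= U)%MS.
  by move=> /affine_hull_sub; rewrite HU.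
have : (map_mx intr (a - b) <= U)%MS.
  rewrite map_mxB ax bY -scalerBr scalemx_sub//.
  have -> : x - y = (x - x0) - (y - x0) by rewrite opprB addrA subrK.
  by rewrite addmx_sub ?Ux// -scaleN1r scalemx_sub// Ux.
move=> /submxP[w wE].
suff : map_mx intr (a - b) = 0 :> 'rV[R]_s.
  move=> ab0; apply/rowP => i; apply/eqP; rewrite -subr_eq0 -(intr_eq0 R).
  by have := congr1 (fun M : 'rV_s => M 0 i) ab0; rewrite !mxE => ->.
(* All columns of [U] are combinations of the selected ones. *)
have UE : U = (rowsub f U^T)^T *m D^T by rewrite -trmx_mul -HD trmxK.
rewrite wE UE mulmxA; suff -> : w *m (rowsub f U^T)^T = 0 by rewrite mul0mx.
apply/rowP => j; rewrite !mxE.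
have := congr1 (fun M : 'rV_s => M 0 (f j)) wE; rewrite !mxE abf subrr => E.
by rewrite -[RHS]/((0 : int)%:~R) E; apply: eq_bigr => i _; rewrite !mxE.
Qed.

Lemma monomial_sum_le d (e : multinom s) n : has_dim P d ->
  (monomial_sum R v e n <= coord_bound.+1 ^ (d + mdeg e) * n.+1 ^ (d + mdeg e))%N.
Proof.
move=> dP; rewrite -expnMn.
have nM : (n * coord_bound <= coord_bound.+1 * n.+1)%N.
  by rewrite mulnC leq_mul.
have nM1 : ((n * coord_bound).+1 <= coord_bound.+1 * n.+1)%N.
  by rewrite mulnC mulSn mulnS; lia.
apply: (@leq_trans (\sum_(a <- dilate_fset R v n) (coord_bound.+1 * n.+1) ^ mdeg e)%N).
  rewrite /monomial_sum big_seq [leqRHS]big_seq; apply: leq_sum => a aB.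
  rewrite mdegE expn_sum; apply: leq_prod => i _.
  by apply: leq_expn_base; exact: leq_trans (dilate_fset_le i aB) nM.
rewrite big_const_seq count_predT iter_addn_0 mulnC expnD leq_mul//.
apply: leq_trans (card_dilate_fset_le n dP) _.
exact: leq_expn_base.
Qed.

Lemma dilate_sum (c : 'I_k.+1 -> nat) n : (\sum_j c j = n.+1)%N ->
  \row_i ((\sum_j c j * v j ord0 i)%N%:Z) \in dilate_fset R v n.+1.
Proof.
move=> cn; apply/in_dilate_fset.
exists (\sum_j ((c j)%:R / n.+1%:R) *: V j).
  exists (fun j => (c j)%:R / n.+1%:R); split=> // [j|].
    by rewrite divr_ge0.
  by rewrite -mulr_suml -natr_sum cn divff// pnatr_eq0.
apply/rowP => i; rewrite !mxE summxE mulr_sumr.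
rewrite -[LHS]/((\sum_j c j * v j ord0 i)%N%:R) natr_sum.
apply: eq_bigr => j _; rewrite !mxE natrM; field.
by rewrite nat1r pnatr_eq0.
Qed.

(** The affine hull lies in a translate of the row space of the differences of
    vertices. *)
Lemma dim_le_rank d : has_dim P d ->
  (d <= \rank (\matrix_j (V j - V ord0) : 'M[R]_(k.+1, s)))%N.
Proof.
move=> [x0 [U [HU <-]]]; set V0 := (X in (_ <= \rank X)%N).
have VV0 x : affine_hull P x -> (x - V ord0 <= V0)%MS.
  move=> [l [y [w [Py w1 ->]]]].
  have Py' i : (y i - V ord0 <= V0)%MS.
    have [c [c0 c1 ->]] := Py i.
    have -> : \sum_j c j *: V j - V ord0 = \sum_j c j *: (V j - V ord0).
      under [RHS]eq_bigr do rewrite scalerBr.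
      by rewrite sumrB -scaler_suml c1 scale1r.
    apply: summx_sub => j _; apply: scalemx_sub.
    by have := row_sub j V0; rewrite rowK.
  have -> : \sum_j w j *: y j - V ord0 = \sum_j w j *: (y j - V ord0).
    under [RHS]eq_bigr do rewrite scalerBr.
    by rewrite sumrB -scaler_suml w1 scale1r.
  by apply: summx_sub => j _; apply: scalemx_sub.
apply: mxrankS; apply/row_subP => i.
have -> : row i U = (x0 + row i U - V ord0) - (x0 - V ord0).
  by rewrite opprB addrA subrK addrC addKr.
apply: addmx_sub; first by apply: VV0; rewrite HU /= addrC addKr row_sub.
by rewrite -scaleN1r scalemx_sub// VV0// HU /= subrr sub0mx.
Qed.

(** The points are [t (sum_j v_j) + sum_i (z_i v_(f i) + (t - z_i) v_0)] with
    [0 <= z_i <= t], where the differences [v_(f i) - v_0] form a basis: nonnegative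
    combinations of vertices of constant total weight [t (k.+1 + r)], distinct for
    distinct [z].  The first term makes every coordinate at least [t] when the vertices
    are non-degenerate. *)
Lemma monomial_sum_ge d (e : multinom s) : nondegenerate_vertices v ->
  has_dim P d -> exists2 q, (0 < q)%N &
  forall t, (0 < t)%N -> (t ^ (d + mdeg e) <= monomial_sum R v e (t * q))%N.
Proof.
move=> ndv /dim_le_rank; set V0 := \matrix_j _ => dr.
pose f := maxrankfun V0; pose r := \rank V0.
exists (k.+1 + r)%N => // t t0.
pose c (z : {ffun 'I_r -> 'I_t.+1}) j : nat :=
  (t + \sum_i (z i * (f i == j) + (t - z i) * (j == ord0)))%N.
pose h z : 'rV[int]_s := \row_i ((\sum_j c z j * v j ord0 i)%N%:Z).
have sum1 (j0 : 'I_k.+1) : (\sum_j (j0 == j) = 1)%N.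
  by rewrite (bigD1 j0)//= eqxx big1// => j; rewrite eq_sym => /negPf->.
have cn z : (\sum_j c z j = t * (k.+1 + r))%N.
  rewrite big_split sum_nat_const card_ord exchange_big/= mulnDr mulnC; congr (_ + _)%N.
  rewrite (eq_bigr (fun=> t)) ?sum_nat_const ?card_ord ?(mulnC r)// => i _.
  rewrite big_split -!big_distrr/= sum1.
  under [X in (_ + _ * X)%N]eq_bigr do rewrite eq_sym.
  by rewrite sum1 !muln1 subnKC// -ltnS.
have hB z : h z \in dilate_fset R v (t * (k.+1 + r)).
  have n0 : (0 < t * (k.+1 + r))%N by rewrite muln_gt0 t0.
  by rewrite -(prednK n0); apply: dilate_sum; rewrite prednK// cn.
have hge z i : (t <= `|(h z ord0 i)%R|)%N.
  rewrite mxE absz_nat; have [j vj] := ndv i.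
  rewrite (bigD1 j)//= -[t]muln1; apply: leq_trans (leq_addr _ _).
  by rewrite leq_mul ?leq_addr// lt0n.
have hE z : map_mx intr (h z) = t%:R *: (\sum_j V j) + (t * r)%:R *: V ord0 +
    (\row_i (z i)%:R) *m rowsub f V0 :> 'rV[R]_s.
  apply/rowP => i; rewrite !mxE summxE.
  rewrite -[LHS]/((\sum_j c z j * v j ord0 i)%N%:R) /c.
  under eq_bigr do rewrite mulnDl.
  rewrite big_split natrD -addrA; congr (_ + _).
    rewrite natr_sum mulr_sumr; apply: eq_bigr => j _.
    by rewrite natrM mxE.
  under eq_bigr do rewrite big_distrl.
  rewrite exchange_big natr_sum/= natrM.
  have -> : t%:R * r%:R * (v ord0 ord0 i)%:R = \sum_(j < r) t%:R * (v ord0 ord0 i)%:R :> R.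
    by rewrite sumr_const card_ord -mulr_natr; ring.
  rewrite -big_split; apply: eq_bigr => j _ /=; rewrite !mxE.
  under eq_bigr do rewrite mulnDl.
  have pick w (j0 : 'I_k.+1) : (\sum_l w * (l == j0) * v l ord0 i = w * v j0 ord0 i)%N.
    rewrite (bigD1 j0)//= eqxx muln1 big1 ?addn0// => l /negPf->.
    by rewrite muln0 mul0n.
  rewrite big_split natrD pick.
  under [X in X%:R + _]eq_bigr do rewrite eq_sym.
  have zt : (z j <= t)%N by rewrite -ltnS ltn_ord.
  by rewrite pick !natrM (natrB _ zt); ring.
have hinj : injective h.
  move=> z z' zz'; have := hE z; rewrite zz' hE => /addrI/esym.
  move=> /(row_free_inj (maxrowsub_free V0)) E; apply/ffunP => i; apply: val_inj.
  have := congr1 (fun M : 'rV_r => M 0 i) E; rewrite !mxE => /eqP.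
  by rewrite eqr_nat => /eqP.
rewrite -(ler_nat R) /monomial_sum natr_sum.
have := @card_scale_le_sum R _ _ (dilate_fset R v (t * (k.+1 + r))) h
  (fun a => (\prod_i `|(a ord0 i)%R| ^ e i)%N%:R) ((t ^ mdeg e)%N%:R) hinj hB.
move/(_ (fun _ _ => ler0n _ _)) => H; apply: le_trans (H _).
  rewrite card_ffun !card_ord -natrM ler_nat expnD leq_mul//.
  apply: (@leq_trans (t ^ r)); first by rewrite leq_pexp2l.
  exact: leq_expn_base.
move=> z; rewrite ler_nat mdegE expn_sum; apply: leq_prod => i _.
by apply: leq_expn_base; exact: hge.
Qed.

End Growth.

(** * Growth for a nonnegative homogeneous weight *)

Lemma poly_itv_eq0 (R : realFieldType) (q : {poly R}) (a e : R) : 0 < e ->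
  (forall t, `|t - a| < e -> q.[t] = 0) -> q = 0.
Proof.
move=> e0 Hq; apply: contraTeq isT => q0.
pose rs := [seq a + e / k.+2%:R | k <- iota 0 (size q)].
have := @max_poly_roots _ q rs q0; rewrite size_map size_iota ltnn.
apply.
  apply/allP => _ /mapP[k _ ->]; apply/rootP/Hq.
  rewrite addrC addKr ger0_norm ?divr_ge0 ?ltW//.
  by rewrite ltr_pdivrMr// ltr_pMr// ltr1n.
rewrite map_inj_uniq ?iota_uniq// => k l /addrI /(mulfI (lt0r_neq0 e0)) /invr_inj.
by move/eqP; rewrite eqr_nat => /eqP[].
Qed.

(** Separate the variables one at a time: a univariate polynomial that vanishes on
    an interval has zero coefficients. *)
Lemma meval_box_eq0 (R : realFieldType) (s : nat) (f : mpoly s R)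
    (a : 'I_s -> R) (e : R) : 0 < e ->
  (forall x : 'I_s -> R, (forall i, `|x i - a i| < e) -> meval x f = 0) -> f = 0.
Proof.
move=> e0 Hf.
have claim (l : seq 'I_s) : uniq l -> forall (m : multinom s) (x : 'I_s -> R),
    (forall i, `|x i - a i| < e) ->
    \sum_(u <- msupp f | all (fun i => u i == m i) l)
      mcoeff u f * \prod_(i | i \notin l) x i ^+ u i = 0.
  elim: l => [_ m x /Hf|i l IH /=/andP[il ul] m x xa]; first by rewrite mevalE.
(* The partial sum as a polynomial in the variable [i], the others being fixed. *)
  pose q := \sum_(u <- msupp f | all (fun j => u j == m j) l)
    (mcoeff u f * \prod_(j | j \notin i :: l) x j ^+ u j) *: 'X^(u i).
  have q0 : q = 0.
    apply: (poly_itv_eq0 e0 (a := a i)) => t ta.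
    pose x' j := if j == i then t else x j.
    have x'a j : `|x' j - a j| < e by rewrite /x'; case: eqP => [->|].
    rewrite -(IH ul m x' x'a) horner_sum; apply: eq_bigr => u _.
    rewrite hornerZ hornerXn -mulrA; congr (_ * _).
    rewrite [RHS](bigD1 i)//= {1}/x' eqxx mulrC; congr (_ * _).
    apply: eq_big => [j|j]; first by rewrite inE negb_or andbC.
    by rewrite inE negb_or => /andP[/negPf ji _]; rewrite /x' ji.
  have := congr1 (fun g : {poly R} => g`_(m i)) q0.
  rewrite coef0 coef_sum => {2}<-; rewrite [LHS]big_mkcondl; apply: eq_bigr => u _.
  by rewrite coefZ coefXn eq_sym; case: eqP; rewrite ?mulr1 ?mulr0.
apply/mpolyP => m; rewrite mcoeff0; apply/eqP.
have [mf|] := boolP (m \in msupp f); last by rewrite mcoeff_eq0.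
have aa i : `|a i - a i| < e by rewrite subrr normr0.
have := claim (enum 'I_s) (enum_uniq _) m a aa.
rewrite -big_filter (perm_big [:: m]); last first.
  apply: uniq_perm; rewrite ?filter_uniq ?msupp_uniq// => u.
  rewrite mem_filter inE; apply/andP/eqP => [[/allP um _]|->].
    by apply/mnmP => i; apply/eqP/um; rewrite mem_enum.
  by split=> //; apply/allP => i _.
rewrite big_seq1 big1 ?mulr1; last by move=> i; rewrite mem_enum.
by move=> ->.
Qed.

Lemma meval_homog (s : nat) (K : fieldType) (f : mpoly s K) (p : nat) (c : K)
    (x : 'I_s -> K) : f \is ishomog1 p mdeg ->
  meval (fun i => c * x i) f = c ^+ p * meval x f.
Proof.
move=> /dhomogP Hf; rewrite !mevalE mulr_sumr; apply: eq_big_seq => u /Hf up.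
have {}up : mdeg u = p := up.
have -> : c ^+ p = \prod_i c ^+ u i by rewrite -up mdegE prodrXr.
rewrite [RHS]mulrCA -big_split; congr (_ * _).
by apply: eq_bigr => i _; rewrite exprMn.
Qed.

Lemma meval_continuous (R : realType) (s : nat) (f : mpoly s R) :
  continuous (fun y : 'rV[R]_s => meval (fun i => y 0 i) f).
Proof.
have -> : (fun y : 'rV[R]_s => meval (fun i => y 0 i) f) =
    fun y => \sum_(u <- msupp f) mcoeff u f * \prod_i y 0 i ^+ u i.
  by apply/funext => y; rewrite mevalE.
apply: continuous_big => [|u _]; first exact: add_continuous.
have prodC : continuous (fun y : 'rV[R]_s => \prod_i y 0 i ^+ u i).
  apply: continuous_big => [|i _]; first exact: mul_continuous.
  elim: (u i) => [|j IH]; first exact: cst_continuous.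
  rewrite (_ : (fun _ => _) = fun y : 'rV[R]_s => y 0 i * y 0 i ^+ j).
    move=> y; apply: (@continuousM R _ (fun z : 'rV[R]_s => z 0 i)
      (fun z => z 0 i ^+ j) y); [exact: coord_continuous | exact: IH].
  by apply/funext => y; rewrite exprS.
by move=> y; apply: continuousM; [exact: cst_continuous | exact: prodC].
Qed.

Section HomogeneousGrowth.
Variables (R : realType) (s k : nat) (v : 'I_k.+1 -> 'rV[nat]_s).
Let P : set 'rV[R]_s := nat_polytope v.

Lemma homog_positive_ball (f : mpoly s R) : f != 0 -> interior P !=set0 ->
  (forall x, P x -> 0 <= meval (fun i => x 0 i) f) ->
  exists (x : 'rV[R]_s) (e c : R), [/\ 0 < e, 0 < c &
    forall y, ball x e y -> P y /\ c <= meval (fun i => y 0 i) f].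
Proof.
move=> f0 [x0 x0P] Pf.
have /nbhs_ballP[e0 /= e00 He0] : nbhs x0 (interior P).
  by apply: open_nbhs_nbhs; split=> //; exact: open_interior.
have [y [yx0 fy]] : exists y : 'rV[R]_s, ball x0 e0 y /\ meval (fun i => y 0 i) f != 0.
  apply: contrapT => /forallNP H; move/eqP: f0; apply.
  apply: (meval_box_eq0 e00 (a := fun i => x0 0 i)) => x xa.
  apply/eqP; apply: contra_notT (H (\row_i x i)) => fx; split.
    split=> // i j; rewrite mxE !ord1 /ball /= distrC; exact: xa.
  by move: fx; rewrite (meval_eq (v2 := fun i => (\row_i0 x i0) 0 i))// => i; rewrite mxE.
have yP : interior P y by exact: He0.
have fy0 : 0 < meval (fun i => y 0 i) f.
  by rewrite lt_neqAle eq_sym fy Pf//; exact: interior_subset.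
set c := meval _ f in fy0.
have /nbhs_ballP[e /= e_gt0 He] : nbhs y (P `&` [set z | c / 2 < meval (fun i => z 0 i) f]).
  apply: filterI; first exact: yP.
  apply: (cvgr_gt c (@meval_continuous R s f y)).
  by rewrite ltr_pdivrMr// ltr_pMr// ltr1n.
exists y, e, (c / 2); split=> //; first by rewrite divr_gt0.
by move=> z /He[Pz /ltW].
Qed.

(** With [1 / q < e], the lattice points of a cube of side [t] near [n x] lie, after
    division by [n = t q], in the ball of radius [e] around [x]. *)
Lemma weighted_ehrhart_ge (f : mpoly s R) (p : nat) : f != 0 ->
  f \is ishomog1 p mdeg -> interior P !=set0 ->
  (forall x, P x -> 0 <= meval (fun i => x 0 i) f) ->
  exists (c : R) (q : nat), [/\ 0 < c, (0 < q)%N & forall t, (0 < t)%N ->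
    c * (t * q)%:R ^+ (s + p) <= weighted_ehrhart P f (t * q)].
Proof.
move=> f0 fh intP Pf.
have [x [e [c [e0 c0 He]]]] := homog_positive_ball f0 intP Pf.
have [q q_gt0 qe] : exists2 q, (0 < q)%N & q%:R^-1 < e.
  exists (Num.bound e^-1).+1 => //.
  rewrite invf_plt ?posrE ?ltr0n//; apply: le_lt_trans (ler_norm _) _.
  apply: lt_le_trans (archi_boundP (normr_ge0 _)) _.
  by rewrite ler_nat /Num.bound normr_id.
have q0 : 0 < q%:R :> R by rewrite ltr0n.
exists (c / q%:R ^+ s), q; split=> //; first by rewrite divr_gt0// exprn_gt0.
move=> t t0; set n := (t * q)%N.
have n0 : 0 < n%:R :> R by rewrite ltr0n muln_gt0 t0.
have evalE a y : map_mx intr a = n%:R *: y :> 'rV[R]_s ->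
    meval (fun i => (a 0 i)%:~R) f = n%:R ^+ p * meval (fun i => y 0 i) f.
  move=> ay; rewrite -meval_homog//; apply: meval_eq => i.
  by have := congr1 (fun M : 'rV_s => M 0 i) ay; rewrite !mxE.
pose h (z : {ffun 'I_s -> 'I_t}) : 'rV[int]_s :=
  \row_i (Num.floor (n%:R * x 0 i) + (z i)%:Z).
have hball z : ball x e (n%:R^-1 *: map_mx intr (h z)).
  split=> // i j; rewrite ord1 /ball/= !mxE distrC.
  have -> : n%:R^-1 * (Num.floor (n%:R * x 0 j) + (z j)%:Z)%:~R - x 0 j =
      n%:R^-1 * ((z j)%:R + (Num.floor (n%:R * x 0 j))%:~R - n%:R * x 0 j) :> R.
    rewrite intrD; field; exact: lt0r_neq0.
  rewrite normrM ger0_norm ?invr_ge0 ?ltW// mulrC ltr_pdivrMr//.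
  apply: (@le_lt_trans _ _ t%:R); last first.
    suff -> : t%:R = q%:R^-1 * n%:R :> R by rewrite ltr_pM2r.
    by rewrite /n natrM mulrCA mulVf ?mulr1// lt0r_neq0.
  have /andP[f1 f2] := Num.Theory.floor_itv (n%:R * x 0 j).
  have zt : (z j).+1%:R <= t%:R :> R by rewrite ler_nat.
  have t1 : 1 <= t%:R :> R by rewrite ler1n.
  have z0 : 0 <= (z j)%:R :> R by [].
  rewrite intrD in f2; rewrite -natr1 in zt.
  by rewrite ler_norml; apply/andP; split; lra.
have hn z : map_mx intr (h z) = n%:R *: (n%:R^-1 *: map_mx intr (h z)) :> 'rV[R]_s.
  by rewrite scalerA divff ?scale1r// lt0r_neq0.
have hinj : injective h.
  move=> z z' /rowP zz'; apply/ffunP => i; apply: val_inj.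
  by have := zz' i; rewrite !mxE => /addrI[].
rewrite /weighted_ehrhart fsbig_finite/=; last exact: finite_dilate.
have := @card_scale_le_sum R _ _ (dilate_fset R v n) h
  (fun a => meval (fun i => (a 0 i)%:~R) f) (n%:R ^+ p * c) hinj.
move=> H; apply: le_trans (H _ _ _).
- rewrite card_ffun !card_ord exprD mulrA natrX /n natrM exprMn.
  rewrite le_eqVlt; apply/orP; left; apply/eqP; field.
  by rewrite expf_neq0// lt0r_neq0.
- move=> z; apply/in_dilate_fset; exists (n%:R^-1 *: map_mx intr (h z)) => //.
  by have [] := He _ (hball z).
- move=> a /in_dilate_fset[y Py ay].
  by rewrite (evalE _ _ ay) mulr_ge0 ?exprn_ge0 ?Pf.
- move=> z; rewrite (evalE _ _ (hn z)) ler_wpM2l ?exprn_ge0//.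
  by have [] := He _ (hball z).
Qed.

End HomogeneousGrowth.

(** * The theorem *)

Section MonomialPolynomials.
Variables (R : realType) (s k : nat) (v : 'I_k.+1 -> 'rV[nat]_s) (d : nat).
Hypothesis dimP : has_dim (nat_polytope v : set 'rV[R]_s) d.

Lemma monomial_sum_poly (e : multinom s) : exists2 g : {poly R},
  forall n, (monomial_sum R v e n)%:R = g.[n%:R] & (size g <= (d + mdeg e).+1)%N.
Proof.
have [g Hg] := ehrhart_span_poly (ehrhart_span_monomial_sum R R v e).
exists g => //; pose C := ((\sum_i \sum_j v j ord0 i).+1 ^ (d + mdeg e))%N.
apply: (@size_poly_of_le_growth _ _ C%:R) => n.
by rewrite -Hg ger0_norm// -natrX -natrM ler_nat monomial_sum_le.
Qed.

Lemma monomial_sum_poly_size (e : multinom s) (g : {poly R}) :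
  nondegenerate_vertices v ->
  (forall n, (monomial_sum R v e n)%:R = g.[n%:R]) -> (d + mdeg e < size g)%N.
Proof.
move=> ndv Hg; have [q q0 Hq] := monomial_sum_ge e ndv dimP.
have q0' : q%:R != 0 :> R by rewrite pnatr_eq0 -lt0n.
apply: (@size_poly_of_ge_growth _ _ (q%:R ^- (d + mdeg e))).
  by rewrite invr_gt0 exprn_gt0// ltr0n.
move=> N; exists (N.+1 * q)%N; first by rewrite (leq_trans (leqnSn N))// leq_pmulr.
rewrite -Hg natrM exprMn mulrCA mulVf ?expf_neq0// mulr1 -natrX ler_nat.
exact: Hq.
Qed.

End MonomialPolynomials.

Section WeightedPolynomials.
Variables (R : realType) (s k : nat) (v : 'I_k.+1 -> 'rV[nat]_s) (d : nat).
Hypothesis dimP : has_dim (nat_polytope v : set 'rV[R]_s) d.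
Variables (K : fieldType) (iota : {rmorphism R -> K}).

(** The degree bound is obtained for each monomial over [R], where growth makes
    sense, and transported to [K] along [iota]. *)
Lemma weighted_ehrhart_poly (f : mpoly s K) (p : nat) : mmeasure mdeg f = p.+1 ->
  exists2 g : {poly K},
    represents g (weighted_ehrhart (nat_polytope v : set 'rV[R]_s) f) &
    (size g <= (d + p).+1)%N.
Proof.
move=> fp; have /choice[g Hg] : forall e : multinom s, exists g : {poly R},
    (forall n, (monomial_sum R v e n)%:R = g.[n%:R]) /\
    (size g <= (d + mdeg e).+1)%N.
  by move=> e; have [g] := monomial_sum_poly dimP e; exists g.
exists (\sum_(e <- msupp f) mcoeff e f *: map_poly iota (g e)).
  move=> n; rewrite weighted_ehrhartE horner_sum; apply: eq_bigr => e _.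
  by rewrite hornerZ -(rmorph_nat iota n) horner_map -(Hg e).1 rmorph_nat.
apply: (leq_trans (size_sum _ _ _)); apply/bigmax_leqP_seq => e ef _.
apply: (leq_trans (size_scale_leq _ _)); rewrite size_map_poly.
apply: (leq_trans (Hg e).2); rewrite ltnS leq_add2l -ltnS -fp.
exact: (mmeasure_mnm_lt _ ef).
Qed.

Lemma weighted_ehrhart_monomial_poly (c : K) (e : multinom s) : c != 0 ->
  nondegenerate_vertices v -> exists2 g : {poly K},
    represents g (weighted_ehrhart (nat_polytope v : set 'rV[R]_s) (c *: mpolyX K e)) &
    size g = (d + mdeg e).+1.
Proof.
move=> c0 ndv; have [g Hg sg] := monomial_sum_poly dimP e.
exists (c *: map_poly iota g).
  move=> n; rewrite weighted_ehrhartE (perm_big _ (msuppZ _ c0)) msuppX big_seq1/=.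
  rewrite mcoeffZ mcoeffX eqxx mulr1 hornerZ -(rmorph_nat iota n) horner_map -Hg.
  by rewrite rmorph_nat.
rewrite size_scale// size_map_poly; apply/eqP; rewrite eqn_leq sg.
exact: (monomial_sum_poly_size dimP).
Qed.

End WeightedPolynomials.

Theorem corollary5p2 (R : realType) (s m : nat) (v : 'I_m -> 'rV[nat]_s)
    (P : set 'rV[R]_s) (d : nat) (m_gt0 : (0 < m)%N)
    (defP : P = convex_hull (fun j => map_mx (fun k : nat => k%:R) (v j)))
    (dimP : has_dim P d) :
  (forall (K : fieldType) (iota : {rmorphism R -> K}) (f : mpoly s K)
      (p : nat),
    f != 0 -> mmeasure mdeg f = p.+1 ->
    [/\ (* (a) *)
        (exists2 g : {poly K}, represents g (weighted_ehrhart P f)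
                             & (size g <= (d + p).+1)%N)
          /\ rational_series (weighted_ehrhart P f),
        (* (b) *)
        nondegenerate_vertices v ->
        (exists (c : K) (e : multinom s), f = c *: mpolyX K e) ->
        exists2 g : {poly K}, represents g (weighted_ehrhart P f)
                            & size g = (d + p).+1
      & (* (c) *)
        exists (r : nat) (c : 'I_r -> K) (e : 'I_r -> nat -> nat),
          (forall i, ehrhart_polynomial R (e i)) /\
          forall n, weighted_ehrhart P f n = \sum_i c i * (e i n)%:R])
  /\ (* (d) *)
  (forall (f : mpoly s R) (p : nat),
    f != 0 -> mmeasure mdeg f = p.+1 ->
    interior P !=set0 ->
    f \is ishomog1 p mdeg ->
    (forall x, P x -> 0 <= meval (fun i => x 0 i) f) ->
    exists2 g : {poly R}, represents g (weighted_ehrhart P f)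
                        & size g = (s + p).+1).
Proof.
case: m m_gt0 v defP => [//|k] _ {}v defP.
have {}defP : P = nat_polytope v by [].
rewrite {}defP in dimP *; split=> [K iota f p f0 fp|f p f0 fp intP fh Pf].
  have [g Hg sg] := weighted_ehrhart_poly dimP iota fp.
  split.
  - split; first by exists g.
    exact: rational_series_of_poly Hg.
  - move=> ndv [c [e fE]].
    have c0 : c != 0 by apply: contra_neq f0 => c0; rewrite fE c0 scale0r.
    have -> : p = mdeg e.
      by move: fp; rewrite fE mmeasureZ// mmeasureX => -[].
    by rewrite fE; exact: (weighted_ehrhart_monomial_poly dimP iota e c0 ndv).
  - exact: ehrhart_span_weighted.
have [g Hg sg] := weighted_ehrhart_poly dimP (GRing.RMorphism.clone _ _ idfun _) fp.
exists g => //; apply/eqP; rewrite eqn_leq; apply/andP; split.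
  apply: (leq_trans sg); rewrite ltnS leq_add2r.
  by have [x0 [U [_ <-]]] := dimP; exact: rank_leq_row.
have [c [q [c0 q0 Hq]]] := weighted_ehrhart_ge f0 fh intP Pf.
apply: (size_poly_of_ge_growth c0) => N; exists (N.+1 * q)%N.
  by rewrite (leq_trans (leqnSn N))// leq_pmulr.
by rewrite -Hg; exact: Hq.
Qed.
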